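(* Suppose that $Q_T$ (or $Q$) exists and that $$\dot x(t)=Ax(t)+Bu(t)+N(\mathfrak u(t)\otimes x(t))+H(x(t)\otimes x(t)),\quad x(0)=0,$$ has a global solution $x$ on $[0,T]$, with output $y(t)=Cx(t)$. Let $W=[q_1\ \dots\ q_{\hat{\mathfrak n}}]$, where $q_1,\dots,q_{\hat{\mathfrak n}}$ ($\hat{\mathfrak n}\le n$) are all orthonormal eigenvectors of $Q_T$ (or of $Q$, respectively) associated with all non-zero eigenvalues. Assume that $P_T$ (or $P$, respectively) exists and is invertible, and that $H$ is symmetric in the sense that $H(v\otimes z)=H(z\otimes v)$ for all $v,z\in\mathbb R^n$. Then there exists a state variable $\hat x:[0,T]\to\mathbb R^{\hat{\mathfrak n}}$ with $y(t)=CW\hat x(t)$ and $$\dot{\hat x}(t)=\hat A\hat x(t)+\hat Bu(t)+\hat N(\mathfrak u(t)\otimes\hat x(t))+\hat H(\hat x(t)\otimes\hat x(t)),\quad\hat x(0)=0,$$ for $t\in[0,T]$, where $$\hat A=W^\top AW,\quad\hat B=W^\top B,\quad\hat N=W^\top N(I\otimes W),\quad\hat H=W^\top H(W\otimes W).$$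
   Context: Setting: $n,m,p\in\mathbb N$, $T>0$, $A\in\mathbb R^{n\times n}$, $B\in\mathbb R^{n\times m}$, $C\in\mathbb R^{p\times n}$, $N=[N_1\ \dots\ N_m]$, $H=[H_1\ \dots\ H_n]$ with $N_k,H_j\in\mathbb R^{n\times n}$, and block-wise transposes $\mathcal N=[N_1^\top\ \dots\ N_m^\top]$, $\mathcal H=[H_1^\top\ \dots\ H_n^\top]$; the controls $u,\mathfrak u:[0,T]\to\mathbb R^m$ are square integrable; $\otimes$ is the Kronecker product. Differential equations are understood in integrated form. Reachability Gramians: $\mathcal L(X)=AX+XA^\top+N(I\otimes X)N^\top$. $Z_{1,T}$ solves $\dot Z_{1,T}=\mathcal L(Z_{1,T})$ on $[0,\infty)$, $Z_{1,T}(0)=BB^\top$, and for $i\ge2$, $\dot Z_{i,T}=\mathcal L(Z_{i,T})$, $Z_{i,T}(0)=H\big(\sum_{k=1}^{i-1}\int_0^TZ_{k,T}(s)\,\mathrm ds\otimes\int_0^TZ_{i-k,T}(s)\,\mathrm ds\big)H^\top$. Observability: $\mathcal L^*(X)=A^\top X+XA+\mathcal N(I\otimes X)\mathcal N^\top$. $\mathcal Z_{1,T}$ solves $\dot{\mathcal Z}_{1,T}=\mathcal L^*(\mathcal Z_{1,T})$, $\mathcal Z_{1,T}(0)=C^\top C$, and for $i\ge2$, $\dot{\mathcal Z}_{i,T}=\mathcal L^*(\mathcal Z_{i,T})$, $\mathcal Z_{i,T}(0)=\mathcal H\big(\sum_{k=1}^{i-1}\int_0^TZ_{k,T}(s)\,\mathrm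 ds\otimes\int_0^T\mathcal Z_{i-k,T}(s)\,\mathrm ds\big)\mathcal H^\top$. $Z_{i,\infty}$, $\mathcal Z_{i,\infty}$ are defined in the same way with $T$ replaced by $\infty$ in the initial values. $P_T=\sum_{i\ge1}\int_0^TZ_{i,T}$, $P=\sum_{i\ge1}\int_0^\infty Z_{i,\infty}$, $Q_T=\sum_{i\ge1}\int_0^T\mathcal Z_{i,T}$, $Q=\sum_{i\ge1}\int_0^\infty\mathcal Z_{i,\infty}$; a Gramian ''exists'' if the defining series (and improper integrals) converge. *)

(* Defs.v *)
From HB Require Import structures.
From mathcomp Require Import all_boot all_order all_algebra.
From mathcomp Require Import all_classical all_reals all_analysis.
From mathcomp Require Export mxtens.

Set Implicit Arguments.
Unset Strict Implicit.
Unset Printing Implicit Defensive.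

Import Order.TTheory GRing.Theory Num.Theory.
Import numFieldNormedType.Exports.

Local Open Scope classical_set_scope.
Local Open Scope ring_scope.

Section MatrixIntegral.
Context {R : realType} {k l : nat}.
Implicit Types (f X : R -> 'M[R]_(k, l)) (t : R).

Definition mx_integrable t f : Prop :=
  forall i j, (@lebesgue_measure R).-integrable `[0, t]
    (fun s => (f s i j)%:E).

Definition mx_integral t f : 'M[R]_(k, l) :=
  \matrix_(i, j) (\int[@lebesgue_measure R]_(s in `[0, t]) f s i j).

(* "the integral of f from 0 to tau exists and equals M"; for tau = +oo it is
   an improper integral *)
Definition is_mx_integral (tau : \bar R) f (M : 'M[R]_(k, l)) : Prop :=
  match tau with
  | t%:E => mx_integrable t f /\ M = mx_integral t f
  | +oo%E => (forall t, 0 <= t -> mx_integrable t f)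
             /\ (mx_integral t f @[t --> +oo] --> M)
  | -oo%E => False
  end.

(* X' = F(t, X), X(0) = X0 on D, in integrated form; D is meant to be an
   interval of nonnegative times containing 0 *)
Definition solves_on (D : set R) (F : R -> 'M[R]_(k, l) -> 'M[R]_(k, l))
    (X0 : 'M[R]_(k, l)) X : Prop :=
  forall t, D t ->
    mx_integrable t (fun s => F s (X s)) /\
    X t = X0 + mx_integral t (fun s => F s (X s)).

End MatrixIntegral.

Definition square_integrable_on {R : realType} {m : nat} (T : R)
    (u : R -> 'cV[R]_m) : Prop :=
  forall i, measurable_fun `[0, T] (fun t => u t i 0) /\
    (@lebesgue_measure R).-integrable `[0, T] (fun t => (u t i 0 ^+ 2)%:E).

(* Kronecker product of column vectors: tensmx has type 'M_(m * n, 1 * 1) *)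
Definition kronv {R : realType} {m n : nat} (u : 'cV[R]_m) (x : 'cV[R]_n) :
  'cV[R]_(m * n) := tensmx u x.

(* [F_1 ... F_k]; mxtens_unindex sends the column c to the pair
   (c %/ n, c %% n) of its block number and its position in that block *)
Definition hblock {R : realType} {k n : nat} (F : 'I_k -> 'M[R]_n) :
    'M[R]_(n, k * n) :=
  \matrix_(i, c) F (mxtens_unindex c).1 i (mxtens_unindex c).2.

(* block-wise transpose [F_1^T ... F_k^T] *)
Definition hblockT {R : realType} {k n : nat} (F : 'I_k -> 'M[R]_n) :
    'M[R]_(n, k * n) :=
  hblock (fun j => (F j)^T).

Definition quad_rhs {R : realType} {n m : nat} (A : 'M[R]_n) (B : 'M[R]_(n, m))
    (N : 'M[R]_(n, m * n)) (H : 'M[R]_(n, n * n)) (u v : R -> 'cV[R]_m)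
    (t : R) (x : 'cV[R]_n) : 'cV[R]_n :=
  A *m x + B *m u t + N *m kronv (v t) x + H *m kronv x x.

Section Gramians.
Context {R : realType} {n m p : nat}.
Variables (A : 'M[R]_n) (B : 'M[R]_(n, m)) (C : 'M[R]_(p, n)).
Variables (N : 'I_m -> 'M[R]_n) (H : 'I_n -> 'M[R]_n).

Definition reach_op (X : 'M[R]_n) : 'M[R]_n :=
  A *m X + X *m A^T + hblock N *m tensmx (1%:M : 'M[R]_m) X *m (hblock N)^T.

Definition obs_op (X : 'M[R]_n) : 'M[R]_n :=
  A^T *m X + X *m A + hblockT N *m tensmx (1%:M : 'M[R]_m) X *m (hblockT N)^T.

(* Families are indexed by i >= 1 and the values at index 0 are irrelevant.
   P_ i stands for the integral of Z i over [0, tau]. *)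
Definition reach_family (tau : \bar R) (Z : nat -> R -> 'M[R]_n)
    (P_ : nat -> 'M[R]_n) : Prop :=
  [/\ solves_on `[0, +oo[ (fun _ => reach_op) (B *m B^T) (Z 1%N),
      forall i, (2 <= i)%N ->
        solves_on `[0, +oo[ (fun _ => reach_op)
          (hblock H *m (\sum_(1 <= k < i) tensmx (P_ k) (P_ (i - k)%N))
             *m (hblock H)^T) (Z i) &
      forall i, (1 <= i)%N -> is_mx_integral tau (Z i) (P_ i)].

(* Q_ i stands for the integral of Y i over [0, tau]. *)
Definition obs_family (tau : \bar R) (P_ : nat -> 'M[R]_n)
    (Y : nat -> R -> 'M[R]_n) (Q_ : nat -> 'M[R]_n) : Prop :=
  [/\ solves_on `[0, +oo[ (fun _ => obs_op) (C^T *m C) (Y 1%N),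
      forall i, (2 <= i)%N ->
        solves_on `[0, +oo[ (fun _ => obs_op)
          (hblockT H *m (\sum_(1 <= k < i) tensmx (P_ k) (Q_ (i - k)%N))
             *m (hblockT H)^T) (Y i) &
      forall i, (1 <= i)%N -> is_mx_integral tau (Y i) (Q_ i)].

(* "the reachability Gramian with horizon tau exists and equals P" *)
Definition is_reach_gramian (tau : \bar R) (P : 'M[R]_n) : Prop :=
  exists Z P_, reach_family tau Z P_ /\
    ((\sum_(1 <= i < k) P_ i) @[k --> \oo] --> P).

(* "the observability Gramian with horizon tau exists and equals Q" *)
Definition is_obs_gramian (tau : \bar R) (Q : 'M[R]_n) : Prop :=
  exists Z P_ Y Q_, [/\ reach_family tau Z P_, obs_family tau P_ Y Q_ &
    (\sum_(1 <= i < k) Q_ i) @[k --> \oo] --> Q].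

End Gramians.

(* The columns of W are orthonormal eigenvectors of Q for non-zero eigenvalues,
   and no such eigenvector is missing: each eigenspace of Q for a non-zero
   eigenvalue is spanned by columns of W. Eigenvectors are column vectors here,
   whereas MathComp's eigenspace uses row vectors. *)
Definition nonzero_eigenbasis {R : realType} {n r : nat} (Q : 'M[R]_n)
    (W : 'M[R]_(n, r)) : Prop :=
  [/\ W^T *m W = 1%:M,
      forall j, exists2 a : R, a != 0 & Q *m col j W = a *: col j W &
      forall (a : R) (v : 'cV[R]_n), a != 0 -> Q *m v = a *: v ->
        exists c : 'cV[R]_r, v = W *m c].

(* Main.v *)
Require Import Defs.
From HB Require Import structures.
From mathcomp Require Import all_boot all_order all_algebra.
From mathcomp Require Import all_classical all_reals all_analysis.
From mathcomp Require Import ring lra.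
Import Order.TTheory GRing.Theory Num.Theory.
Import numFieldNormedType.Exports.
Local Open Scope classical_set_scope.
Local Open Scope ring_scope.
Set Implicit Arguments.
Unset Strict Implicit.
Unset Printing Implicit Defensive.

(** Let [K] be the kernel of the observability Gramian [Q]. The columns of [W]
    form an orthonormal basis of the orthogonal complement of [K], so
    [W *m W^T] is the orthogonal projection along [K]. The heart of the matter
    is that [K] is invisible and invariant: for [z] in [K],
    [C z = 0] and [A z], [N_k z], [H_a z] are in [K]. Granting this, replacing
    [x] by [W W^T x] in the right-hand side of the system changes it by an
    element of [K] only (for the quadratic term one needs the symmetry of [H],
    which moves the component in [K] to the right slot), and [W^T] kills [K].
    Hence [W^T x] solves the reduced system ([quad_rhs_reduce]).

    Why [K] is invariant. [Q] is the sum of the integrals [Q_i] of solutions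
    [Y_i] of a Lyapunov equation [X' = L X], where
    [L X = A^T X + X A + sum_k N_k^T X N_k]. These solutions are positive
    semidefinite ([flow_psd]), so [Q z = 0] forces [Y_i(t) z = 0] for every
    [i] and every [t] in the range of integration. Differentiating in [t]
    gives [L(Y_i(t)) z = 0]. Pairing with [z] leaves
    [sum_k (N_k z)^T Y_i(t) (N_k z) = 0], whence [Y_i(t) N_k z = 0]; what then
    remains of [L(Y_i(t)) z = 0] is [Y_i(t) A z = 0]. Integrating again,
    [N_k z] and [A z] are in [K]. At time [0] one reads off [C^T C z = 0] from
    [i = 1], and from [i = k + j] that the vector stacking the [H_a z] is
    killed by the Kronecker product of [P_k] and [Q_j]. Summed over [k] this
    says that it is killed by the Kronecker product of [P] and [Q_j], and
    since [P] is invertible, [Q_j H_a z = 0] for all [a] and [j].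

    The analysis needed is modest. Solutions of the integral equations are
    continuous and differentiable at positive times ([solves_on_flow]). A
    minimum principle over a compact parameter set ([min_principle]) gives the
    preservation of positivity, with the unit sphere as parameter set, and the
    uniqueness of solutions ([flow_unique]), with a one-point parameter set.
    Uniqueness makes the [P_k] that enter [Q] the same as those that sum to
    [P]. Of the spectral theorem, only the fact that a symmetric matrix without
    nonzero eigenvalue vanishes is used ([sym_no_eigen]); it follows by
    minimizing the quadratic form on the unit sphere. *)

(** * Positive semidefinite matrices *)

Section QuadraticForms.
Context {R : realType}.

Definition qf {n} (S : 'M[R]_n) (v : 'cV[R]_n) : R := (v^T *m S *m v) 0 0.

(** Symmetry is required separately: a real quadratic form only sees the
    symmetric part of its matrix. *)
Definition psd {n} (S : 'M[R]_n) : Prop := S^T = S /\ forall v, 0 <= qf S v.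

Lemma qfE n (S : 'M[R]_n) v : qf S v = \sum_i \sum_j S i j * (v i 0 * v j 0).
Proof.
rewrite /qf mxE exchange_big; apply: eq_bigr => j _ /=.
rewrite mxE mulr_suml; apply: eq_bigr => i _.
by rewrite mxE mulrCA mulrA.
Qed.

Lemma qfD n (S1 S2 : 'M[R]_n) v : qf (S1 + S2) v = qf S1 v + qf S2 v.
Proof. by rewrite /qf mulmxDr mulmxDl mxE. Qed.

Lemma qfZ n a (S : 'M[R]_n) v : qf (a *: S) v = a * qf S v.
Proof. by rewrite /qf -scalemxAr -scalemxAl mxE. Qed.

Lemma qfZr n (S : 'M[R]_n) a v : qf S (a *: v) = a ^+ 2 * qf S v.
Proof.
by rewrite /qf [(a *: v)^T]linearZ /= -!scalemxAl -scalemxAr scalerA mxE.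
Qed.

Lemma qf1E n (v : 'cV[R]_n) : qf 1%:M v = \sum_i v i 0 ^+ 2.
Proof.
rewrite /qf mulmx1 mxE; apply: eq_bigr => i _; by rewrite mxE -expr2.
Qed.

Lemma qf1_ge0 n (v : 'cV[R]_n) : 0 <= qf 1%:M v.
Proof. by rewrite qf1E sumr_ge0 // => i _; rewrite sqr_ge0. Qed.

Lemma qf1_eq0 n (v : 'cV[R]_n) : qf 1%:M v = 0 -> v = 0.
Proof.
rewrite qf1E => /eqP; rewrite psumr_eq0; last by move=> i _; rewrite sqr_ge0.
move=> /allP h; apply/colP => i; rewrite mxE; apply/eqP.
by rewrite -sqrf_eq0; apply: (implyP (h i (mem_index_enum i))).
Qed.

Lemma qf_congr n k (M : 'M[R]_(n, k)) S v :
  qf (M *m S *m M^T) v = qf S (M^T *m v).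
Proof. by rewrite /qf trmx_mul trmxK !mulmxA. Qed.

Lemma psd_congr n k (M : 'M[R]_(n, k)) S : psd S -> psd (M *m S *m M^T).
Proof.
move=> [sS pS]; split; last by move=> v; rewrite qf_congr.
by rewrite !trmx_mul trmxK sS mulmxA.
Qed.

Lemma psd_gram n k (M : 'M[R]_(n, k)) : psd (M *m M^T).
Proof.
have -> : M *m M^T = M *m 1%:M *m M^T by rewrite mulmx1.
apply: psd_congr; split=> [|v].
  exact: trmx1.
exact: qf1_ge0.
Qed.

Lemma psd0 n : psd (0 : 'M[R]_n).
Proof. by split=> [|v]; rewrite ?trmx0 // /qf mulmx0 mul0mx mxE. Qed.

Lemma psdD n (S1 S2 : 'M[R]_n) : psd S1 -> psd S2 -> psd (S1 + S2).
Proof.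
move=> [s1 p1] [s2 p2]; split=> [|v]; first by rewrite linearD /= s1 s2.
by rewrite qfD addr_ge0.
Qed.

(** A polynomial that is nonnegative everywhere and vanishes at [0] has a
    minimum there, so its derivative [b] vanishes. *)
Lemma quad_ge0_lin0 (a b c : R) : (forall t, 0 <= a + t * b + t ^+ 2 * c) ->
  a = 0 -> b = 0.
Proof.
move=> h a0; subst a.
have h1 := h 1; have h2 := h (-1); have c0 : 0 <= c by lra.
have c1 : 0 < c + 1 by lra.
(* [c + 1] rather than [c], which may be zero *)
have := h (- b / (c + 1)); set q := _ / _.
have qE : q * (c + 1) = - b by rewrite divfK ?gt_eqF.
have -> : b = - q * (c + 1) by lra.
move=> hq; have q2 : q ^+ 2 <= 0 by nra.
have : q ^+ 2 == 0 by rewrite eq_le q2 sqr_ge0.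
by rewrite sqrf_eq0 => /eqP ->; lra.
Qed.

(** The form is minimal at [v], so its derivative [2 w^T S v] in every
    direction [w] vanishes. *)
Lemma psd_ker n (S : 'M[R]_n) v : psd S -> qf S v = 0 -> S *m v = 0.
Proof.
move=> [sS pS] v0.
have h (w : 'cV[R]_n) : (w^T *m S *m v) 0 0 = 0.
  suff : 2 * (w^T *m S *m v) 0 0 = 0 by lra.
  apply: (@quad_ge0_lin0 (qf S v) _ (qf S w) _ v0) => t.
  have -> : qf S v + t * (2 * (w^T *m S *m v) 0 0) + t ^+ 2 * qf S w =
      qf S (v + t *: w).
    have vw : (v^T *m S *m w) 0 0 = (w^T *m S *m v) 0 0.
      rewrite -[w^T *m S *m v]trmxK [RHS]mxE !trmx_mul trmxK sS.
      by rewrite mulmxA.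
    rewrite /qf [(v + _)^T]linearD /= [(t *: w)^T]linearZ /= !mulmxDl !mulmxDr.
    have aD (X Y : 'M[R]_1) : (X + Y) 0 0 = X 0 0 + Y 0 0 by rewrite mxE.
    have aZ c (X : 'M[R]_1) : (c *: X) 0 0 = c * X 0 0 by rewrite mxE.
    by rewrite -!scalemxAl -!scalemxAr scalerA !aD !aZ vw; ring.
  exact: pS.
by apply: qf1_eq0; rewrite /qf mulmx1 mulmxA h.
Qed.
End QuadraticForms.

(** * Gram factorizations and Kronecker products *)

Section Factorization.
Context {R : realType}.

(** The deflated matrix is congruent to [S], by the oblique projection
    [1 - (qf S v)^-1 S v v^T] that annihilates [S v]. *)
Lemma psd_deflate n (S : 'M[R]_n) v : psd S -> qf S v != 0 ->
  psd (S - (qf S v)^-1 *: (S *m v *m (S *m v)^T)).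
Proof.
move=> pS c0; have [sS _] := pS; set c := qf S v in c0 *.
have cE : v^T *m S *m v = c%:M by rewrite [LHS]mx11_scalar.
have tE : (S *m v)^T = v^T *m S by rewrite trmx_mul sS.
suff <- : (1%:M - c^-1 *: (S *m v *m v^T)) *m S *m
          (1%:M - c^-1 *: (S *m v *m v^T))^T
        = S - c^-1 *: (S *m v *m (S *m v)^T) by exact: psd_congr.
rewrite [(_ - _)^T]linearB /= [(c^-1 *: _)^T]linearZ /= trmx1 trmx_mul trmxK tE.
rewrite mulmxBr mulmx1 !mulmxBl mul1mx -!scalemxAr -!scalemxAl.
have -> : S *m v *m v^T *m S *m (v *m (v^T *m S)) = c *: (S *m v *m v^T *m S).
  rewrite !mulmxA -(mulmxA (S *m v)) -(mulmxA (S *m v)) cE.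
  by rewrite mul_mx_scalar -!scalemxAl !mulmxA.
by rewrite [c^-1 *: (c *: _)]scalerA mulVf // scale1r !mulmxA subrr subr0.
Qed.

(** Symmetric Gaussian elimination, one basis vector [e_k] at a time: either
    the form vanishes at [e_k], which is then in the kernel already, or
    deflating [S'] at [e_k] puts [e_k] into the kernel, at the price of one more
    column in [M]. *)
Lemma psd_factor_rec n (S : 'M[R]_n) k : psd S ->
  exists l (M : 'M[R]_(n, l)) (S' : 'M[R]_n),
    [/\ S = M *m M^T + S', psd S' & forall i : 'I_n, (i < k)%N -> col i S' = 0].
Proof.
move=> pS; elim: k => [|k [l [M [S' [SE pS' S'0]]]]].
  by exists 0%N, 0, S; split=> //; rewrite mul0mx add0r.
have [kn|nk] := ltnP k n; last first.
  by exists l, M, S'; split=> // i _; apply: S'0; apply: leq_trans nk.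
pose v : 'cV[R]_n := delta_mx (Ordinal kn) 0.
have vE : S' *m v = col (Ordinal kn) S' by rewrite colE.
have [c0|c0] := eqVneq (qf S' v) 0.
  exists l, M, S'; split=> // i; rewrite ltnS leq_eqVlt => /orP[/eqP ik|/S'0 //].
  have -> : i = Ordinal kn by apply: val_inj.
  by rewrite -vE psd_ker.
pose c := qf S' v.
have c_gt0 : 0 < c by rewrite lt_neqAle eq_sym c0 (pS'.2 v).
exists (l + 1)%N, (row_mx M ((Num.sqrt c)^-1 *: (S' *m v))),
  (S' - c^-1 *: (S' *m v *m (S' *m v)^T)); split.
- rewrite tr_row_mx mul_row_col SE -addrA; congr (_ + _).
  rewrite [(_ *: _)^T]linearZ /= -scalemxAl -scalemxAr scalerA -invfM.
  by rewrite -expr2 sqr_sqrtr ?ltW // addrC subrK.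
- exact: psd_deflate.
- have tE : (S' *m v)^T = v^T *m S' by rewrite trmx_mul pS'.1.
  move=> i; rewrite ltnS leq_eqVlt tE => /orP[/eqP ik|/S'0 i0].
    have -> : i = Ordinal kn by apply: val_inj.
    rewrite colE -/v mulmxBl -scalemxAl -!mulmxA.
    rewrite [v^T *m _]mx11_scalar mul_mx_scalar mulmxA -/(qf S' v) -/c.
    by rewrite -scalemxAr scalerA mulVf // scale1r subrr.
  rewrite colE mulmxBl -scalemxAl -!mulmxA -colE i0 !mulmx0.
  by rewrite scaler0 subrr.
Qed.

Lemma psd_factor n (S : 'M[R]_n) : psd S ->
  exists l (M : 'M[R]_(n, l)), S = M *m M^T.
Proof.
move=> /(@psd_factor_rec _ _ n)[l [M [S' [-> _ S'0]]]]; exists l, M.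
suff -> : S' = 0 by rewrite addr0.
apply/matrixP => i j; have /colP/(_ i) := S'0 j (ltn_ord j).
by rewrite !mxE.
Qed.

(** The Kronecker product of two Gram matrices is a Gram matrix. *)
Lemma psd_tens m n (S : 'M[R]_m) (X : 'M[R]_n) :
  psd S -> psd X -> psd (tensmx S X).
Proof.
move=> /psd_factor[k [M ->]] /psd_factor[l [N ->]].
by rewrite -tensmx_mul -trmx_tens; exact: psd_gram.
Qed.

Lemma psd1 n : psd (1%:M : 'M[R]_n).
Proof. by split=> [|v]; [exact: trmx1|exact: qf1_ge0]. Qed.

Lemma mul_hblock_tens1 k n (F : 'I_k -> 'M[R]_n) (X : 'M[R]_n) :
  hblock F *m tensmx (1%:M : 'M[R]_k) X = hblock (fun j => F j *m X).
Proof.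
apply/matrixP => i c; case: (mxtens_indexP c) => a b.
rewrite !mxE mxtens_indexK /=.
rewrite (reindex (@mxtens_index k n)) /=; last first.
  by exists (@mxtens_unindex k n) => z _; rewrite ?mxtens_indexK ?mxtens_unindexK.
transitivity (\sum_a' \sum_b' F a' i b' * ((a' == a)%:R * X b' b)).
  rewrite pair_big /=; apply: eq_bigr => -[a' b'] _ /=.
  by rewrite !mxE !mxtens_indexK /=.
rewrite (bigD1 a) //= [X in _ + X]big1 ?addr0.
  by apply: eq_bigr => b' _; rewrite eqxx mul1r.
by move=> a' /negPf ->; apply: big1 => b' _; rewrite mul0r mulr0.
Qed.

Lemma hblock_kronv k n (F : 'I_k -> 'M[R]_n) (v : 'cV[R]_k) (x : 'cV[R]_n) :
  hblock F *m kronv v x = \sum_j v j 0 *: (F j *m x).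
Proof.
apply/colP => i; rewrite summxE mxE.
rewrite (reindex (@mxtens_index k n)) /=; last first.
  by exists (@mxtens_unindex k n) => z _; rewrite ?mxtens_indexK ?mxtens_unindexK.
transitivity (\sum_a \sum_b F a i b * (v a 0 * x b 0)).
  rewrite pair_big /=; apply: eq_bigr => -[a b] _ /=.
  rewrite !mxE !mxtens_indexK /=; congr (_ * (v _ _ * x _ _)); exact: ord1.
apply: eq_bigr => a _; rewrite !mxE mulr_sumr; apply: eq_bigr => b _.
by rewrite mulrCA.
Qed.

Lemma hblockT_ker k n (F : 'I_k -> 'M[R]_n) (v : 'cV[R]_n) :
  (hblockT F)^T *m v = 0 -> forall j, F j *m v = 0.
Proof.
move=> h j; apply/colP => b.
have /colP/(_ (mxtens_index (j, b))) := h.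
rewrite !mxE => h0; rewrite -[RHS]h0; apply: eq_bigr => a _.
by rewrite !mxE mxtens_indexK.
Qed.

Lemma psd_sum_nat q a b (S : nat -> 'M[R]_q) :
  (forall i, (a <= i < b)%N -> psd (S i)) -> psd (\sum_(a <= i < b) S i).
Proof.
move=> pS; rewrite big_nat; elim/big_ind: _ => //; first exact: psd0.
by move=> *; exact: psdD.
Qed.

Lemma qf_le_sum_nat q a b k (S : nat -> 'M[R]_q) v :
  (forall i, (a <= i < b)%N -> psd (S i)) -> (a <= k < b)%N ->
  qf (S k) v <= qf (\sum_(a <= i < b) S i) v.
Proof.
move=> pS /andP[ak kb].
rewrite (@big_cat_nat _ _ _ k) //=; last exact: ltnW.
rewrite qfD [X in _ + qf X _]big_ltn // qfD addrCA lerDl addr_ge0 //;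
  apply: (psd_sum_nat _).2 => i /andP[ai ib]; apply: pS.
- by rewrite ai (ltn_trans ib).
- by rewrite ib (leq_trans _ ai) // ltnW.
Qed.
End Factorization.

(** * The unit sphere and eigenvectors of symmetric matrices *)

Section Compactness.
Context {R : realType}.

Lemma cvg_sumr {T I : Type} (F : set_system T) {FF : Filter F} (r : seq I)
    (f : I -> T -> R) (a : I -> R) :
  (forall i, f i x @[x --> F] --> a i) ->
  \sum_(i <- r) f i x @[x --> F] --> \sum_(i <- r) a i.
Proof.
move=> h; elim: r => [|i r IH].
  under eq_fun do rewrite big_nil.
  by rewrite big_nil; apply: cvg_cst.
under eq_fun do rewrite big_cons.
by rewrite big_cons; apply: cvgD.
Qed.

Lemma continuous_qf {E : topologicalType} n (S : E -> 'M[R]_n) (v : E -> 'cV[R]_n) :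
  (forall i j, continuous (fun e => S e i j)) ->
  (forall i, continuous (fun e => v e i 0)) ->
  continuous (fun e => qf (S e) (v e)).
Proof.
move=> cS cv e; rewrite /continuous_at qfE.
under eq_fun do rewrite qfE.
apply: cvg_sumr => i; apply: cvg_sumr => j.
by apply: cvgM; [exact: cS|apply: cvgM; exact: cv].
Qed.

(** Row vectors, to fit [rV_compact]. *)
Definition sphere n : set 'rV[R]_n := [set v | qf 1%:M v^T = 1].
Arguments sphere : clear implicits.

Lemma continuous_tr_entry n i : continuous (fun v : 'rV[R]_n => v^T i 0).
Proof.
move=> v; rewrite /continuous_at mxE.
by under eq_fun do rewrite mxE; exact: coord_continuous.
Qed.

Lemma compact_sphere n : compact (sphere n).
Proof.
have cube : compact [set v : 'rV[R]_n | forall i, v ord0 i \in `[(-1 : R), 1]].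
  apply: (@rV_compact _ _ (fun=> `[(-1 : R), 1]%classic)) => _.
  exact: segment_compact.
apply: subclosed_compact cube _.
- rewrite (_ : sphere n = (fun v : 'rV[R]_n => qf 1%:M v^T) @^-1` [set 1]) //.
  apply: preimage_closed; last exact: closed_eq.
  move=> v _; apply: continuous_qf => [i j|i]; last exact: continuous_tr_entry.
  exact: cst_continuous.
- move=> v; rewrite /sphere /= qf1E => v1 i.
  have : v ord0 i ^+ 2 <= 1.
    rewrite -v1 (bigD1 i) //= mxE lerDl sumr_ge0 // => j _; exact: sqr_ge0.
  rewrite -real_normK ?num_real // expr_le1 // => vi.
  by rewrite in_itv /= -ler_norml.
Qed.

Lemma sphere_scale n (w : 'cV[R]_n) : w != 0 ->
  exists2 c, 0 < c & sphere n (c *: w)^T.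
Proof.
move=> w0; have q0 : 0 < qf 1%:M w.
  by rewrite lt_neqAle qf1_ge0 andbT eq_sym; apply: contra w0 => /eqP/qf1_eq0 ->.
exists (Num.sqrt (qf 1%:M w))^-1; first by rewrite invr_gt0 sqrtr_gt0.
by rewrite /sphere /= trmxK qfZr exprVn sqr_sqrtr ?ltW // mulVf ?gt_eqF.
Qed.

(** By homogeneity the form need only be compared on unit vectors. *)
Lemma psd_shift n (S : 'M[R]_n) a : S^T = S ->
  (forall v, sphere n v -> a <= qf S v^T) -> psd (S - a *: 1%:M).
Proof.
move=> sS h; split=> [|w].
  by rewrite linearB /= linearZ /= trmx1 sS.
have [->|w0] := eqVneq w 0; first by rewrite /qf mulmx0 mxE.
have [c c0 sc] := sphere_scale w0.
have := h _ sc; rewrite trmxK qfZr.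
move: sc; rewrite /sphere /= trmxK qfZr => c1.
rewrite -scaleN1r scalerA qfD qfZ => hq.
have c2 : 0 < c ^+ 2 by rewrite exprn_gt0.
rewrite -(pmulr_rge0 _ c2) mulrDr mulrCA c1; lra.
Qed.

(** A minimizer of the Rayleigh quotient is an eigenvector, since it is a zero
    of the semidefinite form of [S - a]. *)
Lemma psd_shift_ker n (S : 'M[R]_n) v :
  psd (S - qf S v^T *: 1%:M) -> sphere n v -> S *m v^T = qf S v^T *: v^T.
Proof.
move=> pS sv; apply/eqP; rewrite -subr_eq0 -[X in _ - _ *: X]mul1mx.
rewrite scalemxAl -mulmxBl; apply/eqP/psd_ker => //.
by rewrite -scaleN1r scalerA qfD qfZ sv; ring.
Qed.

Lemma sym_eigen_min n (S : 'M[R]_n.+1) : S^T = S ->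
  exists (v : 'cV[R]_n.+1) a,
    [/\ v != 0, S *m v = a *: v & psd (S - a *: 1%:M)].
Proof.
move=> sS.
have [||v + vmin] := @compact_EVT_min _ R (fun v : 'rV[R]_n.+1 => qf S v^T)
    (sphere n.+1) _ (@compact_sphere n.+1).
- have [|c _ sc] := @sphere_scale n.+1 (const_mx 1); last by exists (c *: const_mx 1)^T.
  by apply/eqP => /matrixP/(_ ord0 ord0); rewrite !mxE; apply/eqP/oner_neq0.
- apply: continuous_subspaceT => v.
  apply: continuous_qf => [i j|i]; first exact: cst_continuous.
  exact: continuous_tr_entry.
rewrite inE => sv; exists v^T, (qf S v^T).
have pS : psd (S - qf S v^T *: 1%:M).
  by apply: psd_shift => // w sw; apply: vmin; rewrite inE.
split=> //; last exact: psd_shift_ker.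
apply/eqP => v0; move: sv; rewrite /sphere /= v0 /qf mulmx0 mxE.
by move/eqP; rewrite eq_sym oner_eq0.
Qed.

(** The smallest eigenvalues of [S] and of [- S] can only be [0], so [S] and
    [- S] are both positive semidefinite. *)
Lemma sym_no_eigen n (S : 'M[R]_n) : S^T = S ->
  (forall a (v : 'cV[R]_n), a != 0 -> S *m v = a *: v -> v = 0) -> S = 0.
Proof.
case: n S => [|n] S sS h; first by apply/matrixP => -[].
suff ge0 (X : 'M[R]_n.+1) : X^T = X ->
    (forall a (v : 'cV[R]_n.+1), a != 0 -> X *m v = a *: v -> v = 0) ->
    psd X.
  have pS : psd S by exact: ge0.
  have [_ pN] : psd (- S).
    apply: ge0 => [|a v a0]; first by rewrite linearN /= sS.
    rewrite mulNmx => /(congr1 -%R); rewrite opprK -scaleNr.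
    by apply: h; rewrite oppr_eq0.
  have S0 (v : 'cV[R]_n.+1) : S *m v = 0.
    apply: psd_ker => //; have := pS.2 v; have := pN v.
    by rewrite -scaleN1r qfZ; lra.
  by rewrite -[S]mulmx1; apply/matrixP => i j;
     have /matrixP/(_ i 0) := S0 (col j 1%:M); rewrite colE mulmxA -colE !mxE.
move=> sX hX; have [v [a [v0 va pX]]] := sym_eigen_min sX.
have [a0|a0] := eqVneq a 0; first by move: pX; rewrite a0 scale0r subr0.
by rewrite (hX a v a0 va) eqxx in v0.
Qed.

(** The matrix [Q (1 - W W^T)] is symmetric, because [W] spans an invariant
    subspace of [Q]. An eigenvector of it for a nonzero eigenvalue is
    orthogonal to the columns of [W] and is an eigenvector of [Q] for the same
    eigenvalue; but those are spanned by the columns of [W]. *)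
Lemma nonzero_eigenbasis_proj n r (Q : 'M[R]_n) (W : 'M[R]_(n, r)) :
  Q^T = Q -> nonzero_eigenbasis Q W -> Q *m (1%:M - W *m W^T) = 0.
Proof.
move=> sQ [WW Wev Wall].
have [d QW] : exists d : 'rV[R]_r, Q *m W = W *m diag_mx d.
  have /choice[d hd] j : exists a : R, Q *m col j W = a *: col j W.
    by have [a _ ?] := Wev j; exists a.
  exists (\row_j d j); apply/matrixP => i j.
  have -> : (Q *m W) i j = (Q *m col j W) i 0 by rewrite colE mulmxA -colE [RHS]mxE.
  by rewrite hd mul_mx_diag !mxE mulrC.
have WQ : W^T *m Q = diag_mx d *m W^T.
  by rewrite -{1}sQ -trmx_mul QW trmx_mul tr_diag_mx.
apply: sym_no_eigen => [|a v a0].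
  rewrite trmx_mul linearB /= trmx1 trmx_mul trmxK sQ mulmxBl mulmxBr.
  by rewrite mul1mx mulmx1 mulmxA QW -!mulmxA WQ.
move=> hv; have Wv : W^T *m v = 0.
  suff : a *: (W^T *m v) = 0.
    by move/eqP; rewrite scaler_eq0 (negPf a0) => /eqP.
  rewrite scalemxAr -hv mulmxBr mulmx1 mulmxBl mulmxBr !mulmxA WQ.
  by rewrite -(mulmxA (diag_mx d) W^T W) WW mulmx1 subrr.
have [|c vc] := Wall a v a0.
  by rewrite -hv -mulmxA mulmxBl mul1mx -(mulmxA W) Wv mulmx0 subr0.
by move: Wv; rewrite vc mulmxA WW mul1mx => ->; rewrite mulmx0.
Qed.

(** Eigenvectors of a symmetric matrix for different eigenvalues are
    orthogonal. *)
Lemma nonzero_eigenbasis_ker n r (Q : 'M[R]_n) (W : 'M[R]_(n, r)) k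
    (X : 'M[R]_(n, k)) :
  Q^T = Q -> nonzero_eigenbasis Q W -> Q *m X = 0 -> W^T *m X = 0.
Proof.
move=> sQ [_ Wev _] QX; apply/row_matrixP => j; rewrite row_mul row0 -tr_col.
have [a a0 ha] := Wev j.
suff : a *: ((col j W)^T *m X) = 0.
  by move/eqP; rewrite scaler_eq0 (negPf a0) => /eqP.
rewrite scalemxAl; have -> : a *: (col j W)^T = (a *: col j W)^T by rewrite linearZ.
by rewrite -ha trmx_mul sQ -mulmxA QX mulmx0.
Qed.
End Compactness.
Arguments sphere {R} n.

(** * Linear matrix differential equations and a minimum principle *)

Section LinearFlows.
Context {R : realType}.
Notation mu := (@lebesgue_measure R).

Lemma linear_entry k l k' l' (F : {linear 'M[R]_(k, l) -> 'M[R]_(k', l')}) X i j :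
  F X i j = \sum_a \sum_b X a b * F (delta_mx a b) i j.
Proof.
rewrite {1}[X]matrix_sum_delta linear_sum summxE; apply: eq_bigr => a _.
rewrite linear_sum summxE; apply: eq_bigr => b _.
by rewrite linearZ mxE.
Qed.

Lemma cvg_linear_entry {T : Type} (flt : set_system T) {FF : Filter flt}
    k l k' l' (F : {linear 'M[R]_(k, l) -> 'M[R]_(k', l')})
    (f : T -> 'M[R]_(k, l)) (M : 'M[R]_(k, l)) :
  (forall a b, f x a b @[x --> flt] --> M a b) ->
  forall i j, F (f x) i j @[x --> flt] --> F M i j.
Proof.
move=> fM i j; rewrite linear_entry.
under eq_fun do rewrite linear_entry.
apply: cvg_sumr => a; apply: cvg_sumr => b.
by apply: cvgM; [exact: fM|exact: cvg_cst].
Qed.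

Lemma Rintegral_sumr {I : Type} (D : set R) (r : seq I) (f : I -> R -> R) :
  measurable D -> (forall i, mu.-integrable D (EFin \o f i)) ->
  \int[mu]_(x in D) (\sum_(i <- r) f i x) = \sum_(i <- r) \int[mu]_(x in D) f i x.
Proof.
move=> mD intf; elim: r => [|i r IH].
  by under eq_Rintegral do rewrite big_nil; rewrite big_nil Rintegral_cst // mul0r.
under eq_Rintegral do rewrite big_cons.
rewrite big_cons -IH RintegralD //.
rewrite (_ : _ \o _ = fun x => (\sum_(j <- r) (f j x)%:E)%E).
  by apply: integrable_sum => // j _; exact: intf.
by apply/funext => x /=; rewrite sumEFin.
Qed.

(** Entries of [F X] are linear combinations of entries of [X] with constant
    coefficients. *)
Lemma mx_integral_linear k l k' l' (F : {linear 'M[R]_(k, l) -> 'M[R]_(k', l')})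
    t (f : R -> 'M[R]_(k, l)) : mx_integrable t f ->
  mx_integrable t (fun s => F (f s)) /\
  mx_integral t (fun s => F (f s)) = F (mx_integral t f).
Proof.
move=> intf.
have mI : measurable (`[0, t]%classic : set R) by exact: measurable_itv.
have int1 a b i j : mu.-integrable `[0, t]
    (EFin \o (fun s => f s a b * F (delta_mx a b) i j)).
  rewrite (_ : _ \o _ = (fun s => (f s a b)%:E * (F (delta_mx a b) i j)%:E)%E) //.
  by apply: integrableZr => //; exact: intf.
have int2 a i j : mu.-integrable `[0, t]
    (EFin \o (fun s => \sum_b f s a b * F (delta_mx a b) i j)).
  rewrite (_ : _ \o _ = fun s => (\sum_b (f s a b * F (delta_mx a b) i j)%:E)%E).
    by apply: integrable_sum => // b _; exact: int1.
  by apply/funext => s /=; rewrite sumEFin.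
split=> [i j|].
  rewrite (_ : (fun s => _) =
      fun s => (\sum_a (\sum_b f s a b * F (delta_mx a b) i j)%:E)%E).
    by apply: integrable_sum => // a _; exact: int2.
  by apply/funext => s /=; rewrite linear_entry sumEFin.
apply/matrixP => i j; rewrite mxE linear_entry.
under eq_Rintegral do rewrite linear_entry.
rewrite Rintegral_sumr //; apply: eq_bigr => a _.
rewrite Rintegral_sumr //; apply: eq_bigr => b _.
rewrite RintegralZr; [by rewrite mxE|by []|exact: intf].
Qed.

Lemma continuous_Rintegral0 (f : R -> R) :
  (forall t, 0 <= t -> mu.-integrable `[0, t] (EFin \o f)) ->
  continuous (fun t : R => \int[mu]_(s in `[0, t]) f s).
Proof.
move=> intf t; have [t0|t0|->] := ltgtP t 0.
- rewrite /continuous_at [X in _ --> X](_ : _ = 0); last first.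
    by rewrite set_itv_ge ?Rintegral_set0 // -leNgt bnd_simp.
  apply: cvg_near_cst; near=> s.
  have s0 : s < 0 by near: s; exact: lt_nbhsl.
  by rewrite set_itv_ge ?Rintegral_set0 // -leNgt bnd_simp.
- have t1 : 0 < t + 1 by rewrite ltr_wpDr.
  have /within_continuous_continuous : {within `[0, t + 1],
      continuous (fun x => parameterized_integral mu 0 x f)}.
    by apply: parameterized_integral_continuous; [exact: ltW|exact: intf (ltW t1)].
  by apply=> //; rewrite in_itv /= t0 ltrDl ltr01.
- rewrite /continuous_at set_itv1 Rintegral_set1.
  exact: (parameterized_integral_cvg_left ltr01 (intf _ ler01)).
Unshelve. all: by end_near. Qed.

(** The classical form of an autonomous initial value problem. Continuity is
    asked on the whole line, so that no one-sided continuity at [0] has to be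
    handled. *)
Definition flow k l (L : 'M[R]_(k, l) -> 'M[R]_(k, l)) X0 (X : R -> 'M[R]_(k, l)) :=
  [/\ forall i j, continuous (fun t => X t i j),
      X 0 = X0 &
      forall t : R, 0 < t -> forall i j,
        is_derive t 1 (fun s => X s i j) (L (X t) i j)].

(** Bootstrap: the integral of an integrable function is continuous, hence [X]
    and the integrand are continuous, hence the integral is differentiable. The
    function [Y] extends [X] by its initial value to negative times. *)
Lemma solves_on_flow k l (L : {linear 'M[R]_(k, l) -> 'M[R]_(k, l)}) X0 X :
  solves_on `[0, +oo[ (fun _ => L) X0 X ->
  exists Y, flow L X0 Y /\ forall t, 0 <= t -> X t = Y t.
Proof.
move=> sX.
have hX (t : R) : 0 <= t -> mx_integrable t (fun s => L (X s)) /\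
    X t = X0 + mx_integral t (fun s => L (X s)).
  by move=> t0; apply: sX; rewrite /= in_itv /= t0.
pose Y t := X0 + mx_integral t (fun s => L (X s)).
have YE t i j : Y t i j = X0 i j + \int[mu]_(s in `[0, t]) L (X s) i j.
  by rewrite !mxE.
have XY (t : R) : 0 <= t -> X t = Y t by move=> t0; rewrite (hX t t0).2.
have intL i j (t : R) : 0 <= t -> mu.-integrable `[0, t] (EFin \o (fun s => L (X s) i j)).
  by move=> t0; exact: (hX t t0).1.
have cY i j : continuous (fun t => Y t i j).
  move=> t; rewrite /continuous_at YE; under eq_fun do rewrite YE.
  apply: cvgD; first exact: cvg_cst.
  exact: (continuous_Rintegral0 (intL i j)).
exists Y; split=> //; split=> //.
  by apply/matrixP => i j; rewrite YE set_itv1 Rintegral_set1 addr0.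
move=> t t0 i j.
have cL : {for t, continuous (fun s => L (X s) i j)}.
  rewrite /prop_for /continuous_at (XY t (ltW t0)).
  have : L (Y s) i j @[s --> t] --> L (Y t) i j.
    by apply: cvg_linear_entry => a b; exact: cY.
  apply: cvg_trans; apply: near_eq_cvg; near=> s; rewrite XY //.
  by near: s; apply: filterS (lt_nbhsr t0) => s /ltW.
have t1 : t < t + 1 by rewrite ltrDl.
have [||dF FE] := @continuous_FTC1 R (fun s => L (X s) i j) (BLeft 0) t _ t1 _ _ cL.
- by apply: intL; rewrite ltW // (lt_trans t0).
- by rewrite lte_fin.
rewrite (_ : (fun s => Y s i j) =
  cst (X0 i j) + (fun s => \int[mu]_(r in `[0, s]) L (X r) i j)); last first.
  by apply/funext => s; rewrite YE.
rewrite -[L _ _ _]add0r; apply: is_deriveD.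
by apply: DeriveDef => //; rewrite -derive1E FE XY // ltW.
Unshelve. all: by end_near. Qed.

Lemma is_derive_gt0_left (f : R -> R) (t df : R) : 0 < t -> 0 < df ->
  is_derive t 1 f df -> exists s, [/\ 0 <= s, s <= t & f s < f t].
Proof.
move=> t0 df0 [+ dfE]; rewrite /derivable => /cvg_ex[l hl].
have {dfE hl} : h^-1 *: (f (h *: 1 + t) - f t) @[h --> 0^'-] --> df.
  by rewrite -dfE; apply: cvg_dnbhs_at_left; rewrite /derive (cvg_lim _ hl).
move=> /cvgr_gt/(_ _ df0) hgt.
near (0 : R)^'- => h.
have h0 : h < 0 by near: h; exact: nbhs_left_lt.
have hN : - t < h by near: h; apply: nbhs_left_gt; rewrite oppr_lt0.
have : 0 < h^-1 *: (f (h *: 1 + t) - f t) by near: h.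
rewrite [h *: 1]mulr1 => q0; exists (h + t); split; first by lra.
  by lra.
have : h * (h^-1 *: (f (h + t) - f t)) < 0 by rewrite nmulr_rlt0.
by rewrite [h^-1 *: _]mulrC mulrCA divff ?lt_eqF // mulr1 subr_lt0.
Unshelve. all: by end_near. Qed.

(** The function [expR (- c t) * f t e] attains its minimum over
    [[0, t] x K]. If that minimum is negative, it is attained at a time [s > 0],
    and there the time derivative is positive by assumption; so smaller values
    occur just before [s]. *)
Lemma min_principle {E : ptopologicalType} (K : set E) (f df : R -> E -> R) (c : R) :
  compact K -> continuous (fun z : R * E => f z.1 z.2) ->
  (forall e, K e -> 0 <= f 0 e) ->
  (forall (t : R) e, 0 < t -> K e -> is_derive t 1 (f^~ e) (df t e)) ->
  (forall (t : R) e, 0 < t -> K e -> f t e < 0 -> (forall e', K e' -> f t e <= f t e') ->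
     c * f t e < df t e) ->
  forall (t : R) e, 0 <= t -> K e -> 0 <= f t e.
Proof.
move=> cK cf f0 fdf hmin t e t0 Ke; rewrite leNgt; apply/negP => fneg.
pose g (z : R * E) := expR (- c * z.1) * f z.1 z.2.
have cg : continuous g.
  move=> z; apply: cvgM; last exact: cf.
  apply: (@continuous_comp _ _ _ (fun z : R * E => - c * z.1) expR);
    last exact: continuous_expR.
  by apply: cvgM; [exact: cvg_cst|exact: cvg_fst].
have [|||[s a] + gmin] := @compact_EVT_min _ R g (`[0, t]%classic `*` K).
- by exists (t, e); split=> //=; rewrite in_itv /= t0 lexx.
- by apply: compact_setX => //; exact: segment_compact.
- exact: continuous_subspaceT.
rewrite inE => -[/=]; rewrite in_itv /= => /andP[s0 st] Ka.
have gE r b : (g (r, b) < 0) = (f r b < 0) by rewrite /g /= pmulr_rlt0 // expR_gt0.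
have gs : g (s, a) < 0.
  apply: (@le_lt_trans _ _ (g (t, e))); last by rewrite gE.
  by apply: gmin; rewrite inE; split=> //=; rewrite in_itv /= t0 lexx.
have fs : f s a < 0 by rewrite -gE.
have {}s0 : 0 < s.
  rewrite lt_neqAle s0 andbT; apply/eqP => s00.
  by move: fs; rewrite -s00 ltNge f0.
have dfs : c * f s a < df s a.
  apply: hmin => // b Kb; have : g (s, a) <= g (s, b).
    by apply: gmin; rewrite inE; split=> //=; rewrite in_itv /= st ltW.
  by rewrite /g /= ler_pM2l // expR_gt0.
have dg : is_derive s 1 (fun r => g (r, a))
    (expR (- c * s) * (df s a - c * f s a)).
  have de : is_derive s 1 (fun r => expR (- c * r)) (- c * expR (- c * s)).
    rewrite mulrC; apply: (@is_derive1_comp R expR (fun r => - c * r) s _ (- c)).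
    by apply: is_derive_eq (is_deriveZ (- c) (is_derive_id s 1)) _; exact: mulr1.
  rewrite (_ : (fun r => _) = (fun r => expR (- c * r)) * (f^~ a)) //.
  by apply: is_derive_eq (is_deriveM de (fdf s a s0 Ka)) _; rewrite /GRing.scale /=; ring.
have [|r [r0 rs]] := is_derive_gt0_left s0 _ dg.
  by rewrite mulr_gt0 ?expR_gt0 // subr_gt0.
apply/negP; rewrite -leNgt; apply: gmin; rewrite inE; split=> //=.
by rewrite in_itv /= r0 (le_trans rs).
Qed.
End LinearFlows.

(** * Uniqueness and positivity for Lyapunov equations *)

Section LyapunovFlows.
Context {R : realType}.

Lemma flowB k l (L : {linear 'M[R]_(k, l) -> 'M[R]_(k, l)}) X0 Y0 X Y :
  flow L X0 X -> flow L Y0 Y -> flow L (X0 - Y0) (fun t => X t - Y t).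
Proof.
move=> [cX X0E dX] [cY Y0E dY]; split=> [i j||t t0 i j].
- move=> t; rewrite /continuous_at !mxE.
  by under eq_fun do rewrite !mxE; apply: cvgB; [exact: cX|exact: cY].
- by rewrite X0E Y0E.
rewrite linearB !mxE (_ : (fun s => _) = (fun s => X s i j) - (fun s => Y s i j)).
  exact: is_deriveB (dX t t0 i j) (dY t t0 i j).
by apply/funext => s; rewrite !mxE.
Qed.

Lemma linear_dot_bound k l (L : {linear 'M[R]_(k, l) -> 'M[R]_(k, l)}) :
  exists C : R, forall X : 'M[R]_(k, l),
    \sum_a \sum_b X a b * L X a b <= C * \sum_a \sum_b X a b ^+ 2.
Proof.
pose e a b c d : R := `|L (delta_mx c d) a b|.
exists (\sum_a \sum_b \sum_c \sum_d e a b c d) => X.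
set g := \sum_a \sum_b _ ^+ 2.
have Xg a b : X a b ^+ 2 <= g.
  rewrite /g (bigD1 a) //= (bigD1 b) //= -addrA lerDl addr_ge0 ?sumr_ge0 //.
    by move=> *; exact: sqr_ge0.
  by move=> c _; rewrite sumr_ge0 // => *; exact: sqr_ge0.
rewrite mulr_suml; apply: ler_sum => a _; rewrite mulr_suml; apply: ler_sum => b _.
rewrite linear_entry mulr_sumr mulr_suml; apply: ler_sum => c _.
rewrite mulr_sumr mulr_suml; apply: ler_sum => d _.
rewrite mulrA; apply: le_trans (ler_norm _) _; rewrite normrM mulrC.
apply: ler_wpM2l; first exact: normr_ge0.
have := Xg a b; have := Xg c d; have := sqr_ge0 (X a b - X c d).
have := sqr_ge0 (X a b + X c d); rewrite ler_norml => *; apply/andP; split; nra.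
Qed.

(** A Gronwall argument: the minimum principle for [- |Z t|^2], whose parameter
    set is a single point. *)
Lemma flow_zero k l (L : {linear 'M[R]_(k, l) -> 'M[R]_(k, l)}) Z :
  flow L 0 Z -> forall t, 0 <= t -> Z t = 0.
Proof.
move=> [cZ Z0 dZ] t t0; have [C hC] := linear_dot_bound L.
pose g (t : R) := \sum_a \sum_b Z t a b ^+ 2.
have g_ge0 s : 0 <= g s
  by rewrite !sumr_ge0 // => *; rewrite sumr_ge0 // => *; exact: sqr_ge0.
have cg : continuous g.
  by move=> s; apply: cvg_sumr => a; apply: cvg_sumr => b; apply: cvgM; exact: cZ.
have : 0 <= - g t.
  (* beyond [2 * C], so that the inequality is strict where g is positive *)
  pose c := 2 * C + 1.
  apply: (@min_principle R R [set 0] (fun t _ => - g t)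
    (fun t _ => - \sum_a \sum_b 2 * (Z t a b * L (Z t) a b)) c
    (@compact_set1 _ 0) _ _ _ _ t 0) => //.
  - move=> z; apply: cvgN.
    by apply: (@continuous_comp _ _ _ fst g); [exact: cvg_fst|exact: cg].
  - move=> _ _; rewrite oppr_ge0 /g Z0 big1 // => a _; rewrite big1 // => b _.
    by rewrite mxE expr0n.
  - move=> s _ s0 _.
    rewrite (_ : (fun r : R => _) = - (\sum_a \sum_b (fun r => Z r a b) ^+ 2)).
      apply: is_deriveN; apply: is_derive_sum => a; apply: is_derive_sum => b.
      apply: is_derive_eq (is_deriveX 2 (dZ s s0 a b)) _.
      by rewrite expr1; apply: esym; exact: mulrA.
    apply/funext => r; rewrite /g fctE; congr (- _).
    by rewrite fct_sumE; apply: eq_bigr => a _; rewrite fct_sumE.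
  - move=> s _ s0 _ gneg _; have gp : 0 < g s by rewrite -oppr_lt0.
    have -> : \sum_a \sum_b 2 * (Z s a b * L (Z s) a b) =
        2 * \sum_a \sum_b Z s a b * L (Z s) a b.
      by rewrite mulr_sumr; apply: eq_bigr => a _; rewrite mulr_sumr.
    by have := hC (Z s); rewrite -/(g s) /c; nra.
rewrite oppr_ge0 => gt; have {gt} /eqP : g t = 0 by apply/eqP; rewrite eq_le gt g_ge0.
rewrite psumr_eq0; last by move=> a _; rewrite sumr_ge0 // => *; exact: sqr_ge0.
move=> /allP ha; apply/matrixP => a b; rewrite mxE.
have := implyP (ha a (mem_index_enum a)) isT.
rewrite psumr_eq0; last by move=> *; exact: sqr_ge0.
move=> /allP hb; have := implyP (hb b (mem_index_enum b)) isT.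
by rewrite sqrf_eq0 => /eqP.
Qed.

Lemma flow_unique k l (L : {linear 'M[R]_(k, l) -> 'M[R]_(k, l)}) X0 X Y :
  flow L X0 X -> flow L X0 Y -> forall t, 0 <= t -> X t = Y t.
Proof.
move=> fX fY t t0; apply/eqP; rewrite -subr_eq0; apply/eqP.
have := flowB fX fY; rewrite subrr => /flow_zero; exact.
Qed.

(** The common form of the reachability operator ([A] and [hblock N]) and the
    observability operator ([A^T] and [hblockT N]). *)
Definition lyapunov {n k} (A : 'M[R]_n) (F : 'M[R]_(n, k * n)) (X : 'M[R]_n) :=
  A *m X + X *m A^T + F *m tensmx (1%:M : 'M[R]_k) X *m F^T.

Lemma tensmxDr (m n p q : nat) (S : 'M[R]_(m, n)) (a : R) (X Y : 'M[R]_(p, q)) :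
  tensmx S (a *: X + Y) = a *: tensmx S X + tensmx S Y.
Proof. by apply/matrixP => i j; rewrite !mxE mulrDr mulrCA. Qed.

Lemma lyapunov_is_linear n k (A : 'M[R]_n) (F : 'M[R]_(n, k * n)) : linear (lyapunov A F).
Proof.
move=> a X Y; rewrite /lyapunov tensmxDr !mulmxDr !mulmxDl -!scalemxAr -!scalemxAl.
by rewrite !scalerDr [X in X + _ = _]addrACA [LHS]addrACA.
Qed.
HB.instance Definition _ n k (A : 'M[R]_n) (F : 'M[R]_(n, k * n)) :=
  GRing.isLinear.Build R 'M[R]_n 'M[R]_n *:%R (lyapunov A F) (lyapunov_is_linear A F).

Lemma lyapunov_tr n k (A : 'M[R]_n) (F : 'M[R]_(n, k * n)) X :
  (lyapunov A F X)^T = lyapunov A F X^T.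
Proof.
rewrite /lyapunov !linearD /= !trmx_mul !trmxK trmx_tens trmx1 !mulmxA.
by rewrite [X in X + _]addrC.
Qed.

Lemma flow_tr n k (A : 'M[R]_n) (F : 'M[R]_(n, k * n)) X0 X :
  flow (lyapunov A F) X0 X -> flow (lyapunov A F) X0^T (fun t => (X t)^T).
Proof.
move=> [cX X0E dX]; split=> [i j||t t0 i j].
- by under eq_fun do rewrite mxE; exact: cX.
- by rewrite X0E.
- by under eq_fun do rewrite mxE; rewrite -lyapunov_tr mxE; exact: dX.
Qed.

(** A solution and its transpose solve the same initial value problem. *)
Lemma flow_sym n k (A : 'M[R]_n) (F : 'M[R]_(n, k * n)) X0 X :
  X0^T = X0 -> flow (lyapunov A F) X0 X -> forall t, 0 <= t -> (X t)^T = X t.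
Proof.
move=> sX fX; have := flow_tr fX; rewrite sX => /flow_unique; exact.
Qed.

(** The drift terms contain a factor [S v] or [v^T S]. *)
Lemma qf_lyapunov_ker n k (A : 'M[R]_n) (F : 'M[R]_(n, k * n)) S v :
  S^T = S -> S *m v = 0 ->
  qf (lyapunov A F S) v = qf (tensmx (1%:M : 'M[R]_k) S) (F^T *m v).
Proof.
move=> sS Sv; have vS : v^T *m S = 0 by rewrite -[LHS]trmxK trmx_mul trmxK sS Sv trmx0.
rewrite !qfD qf_congr; set q := qf (tensmx _ _) _.
rewrite /qf mulmxA -!(mulmxA _ S) Sv mulmx0 mxE add0r.
by rewrite !mulmxA vS !mul0mx mxE add0r.
Qed.

Lemma qf_sphere_le n (S : 'M[R]_n) v : sphere n v ->
  qf S v^T <= \sum_i \sum_j `|S i j|.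
Proof.
rewrite /sphere /= qf1E => v1.
have vi i : v^T i 0 ^+ 2 <= 1.
  by rewrite -v1 (bigD1 i) //= lerDl sumr_ge0 // => j _; exact: sqr_ge0.
rewrite qfE; apply: ler_sum => i _; apply: ler_sum => j _.
apply: le_trans (ler_norm _) _; rewrite normrM ler_piMr //.
have := vi i; have := vi j; have := sqr_ge0 (v^T i 0 - v^T j 0).
have := sqr_ge0 (v^T i 0 + v^T j 0); rewrite ler_norml => *; apply/andP; split; nra.
Qed.

(** Let [a < 0] be the minimum of [v^T X(s) v] on the unit sphere, attained at
    [v]. Then [S := X(s) - a] is semidefinite with [S v = 0], so
    [v^T L(X(s)) v >= a v^T L(1) v]: the minimum cannot decrease faster than
    exponentially, which is what the minimum principle asks for. *)
Lemma flow_psd n k (A : 'M[R]_n) (F : 'M[R]_(n, k * n)) X0 X :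
  psd X0 -> flow (lyapunov A F) X0 X -> forall t, 0 <= t -> psd (X t).
Proof.
move=> pX0 fX t t0; have sX := flow_sym pX0.1 fX; have [cX X0E dX] := fX.
(* a strict bound for the form of [L 1] on the unit sphere *)
pose c : R := \sum_i \sum_j `|lyapunov A F 1%:M i j| + 1.
suff hX : forall v, sphere n v -> 0 <= qf (X t) v^T.
  by have := psd_shift (sX t t0) hX; rewrite scale0r subr0.
move=> w sw; apply: (@min_principle R 'rV[R]_n (sphere n) (fun t v => qf (X t) v^T)
  (fun t v => qf (lyapunov A F (X t)) v^T) c (@compact_sphere R n) _ _ _ _ t w) => //.
- apply: (@continuous_qf R (R * 'rV[R]_n)%type n (fun z => X z.1) (fun z => z.2^T)).
    move=> i j z; apply: (@continuous_comp _ _ _ fst (fun t => X t i j)).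
      exact: cvg_fst.
    exact: cX.
  move=> i z; apply: (@continuous_comp _ _ _ snd (fun v : 'rV[R]_n => v^T i 0)).
    exact: cvg_snd.
  exact: continuous_tr_entry.
- by move=> v _; rewrite X0E; exact: pX0.2.
- move=> s v s0 _.
  rewrite qfE (_ : (fun s => _) =
      \sum_i \sum_j ((v^T i 0 * v^T j 0) \*: (fun s => X s i j))).
    apply: is_derive_sum => i; apply: is_derive_sum => j.
    apply: is_derive_eq (is_deriveZ (v^T i 0 * v^T j 0) (dX s s0 i j)) _.
    exact: mulrC.
  apply/funext => r; rewrite qfE fct_sumE; apply: eq_bigr => i _.
  by rewrite fct_sumE; apply: eq_bigr => j _; exact: mulrC.
move=> s v s0 sv fneg vmin; set a := qf (X s) v^T in fneg vmin *.
have pS : psd (X s - a *: 1%:M) by apply: psd_shift => //; apply: sX; exact: ltW.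
have Xv := psd_shift_ker pS sv.
set S := X s - a *: 1%:M in pS.
have Sv : S *m v^T = 0 by rewrite mulmxBl Xv -scalemxAl mul1mx subrr.
have -> : X s = S + a *: 1%:M by rewrite subrK.
rewrite linearD linearZ /= qfD qfZ qf_lyapunov_ker ?pS.1 //.
have := (psd_tens (psd1 (R:=R) k) pS).2 (F^T *m v^T).
by have := qf_sphere_le (lyapunov A F 1%:M) sv; rewrite /c; nra.
Qed.
End LyapunovFlows.

(** * Kernels of integrals of semidefinite solutions *)

Section GramianIntegrals.
Context {R : realType}.
Notation mu := (@lebesgue_measure R).
Implicit Types (tau : \bar R) (t : R).

Lemma cvgr_unique {T : Type} (flt : set_system T) {FF : ProperFilter flt}
    (f : T -> R) (a b : R) :
  f x @[x --> flt] --> a -> f x @[x --> flt] --> b -> a = b.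
Proof. exact: (@cvg_unique _ (@Rhausdorff R)). Qed.

Lemma cvg_mx_entry {T : Type} (flt : set_system T) {FF : Filter flt} k l
    (f : T -> 'M[R]_(k, l)) (M : 'M[R]_(k, l)) :
  f x @[x --> flt] --> M -> forall i j, f x i j @[x --> flt] --> M i j.
Proof.
move=> fM i j.
exact: (@cvg_comp _ _ _ f (fun N : 'M[R]_(k, l) => N i j) _ _ _ fM
  (@coord_continuous _ _ _ i j M)).
Qed.

Arguments cvg_mx_entry {T flt FF k l f M} fM i j.

Lemma cvg_qf {T : Type} (flt : set_system T) {FF : Filter flt} n
    (f : T -> 'M[R]_n) (M : 'M[R]_n) v :
  f x @[x --> flt] --> M -> qf (f x) v @[x --> flt] --> qf M v.
Proof.
move=> /cvg_mx_entry fM; rewrite qfE; under eq_fun do rewrite qfE.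
apply: cvg_sumr => i; apply: cvg_sumr => j.
by apply: cvgM; [exact: fM|exact: cvg_cst].
Qed.

Lemma cvg_psd {T : Type} (flt : set_system T) {FF : ProperFilter flt} n
    (f : T -> 'M[R]_n) (M : 'M[R]_n) :
  f x @[x --> flt] --> M -> (\forall x \near flt, psd (f x)) -> psd M.
Proof.
move=> fM pf; split=> [|v].
  apply/matrixP => i j; rewrite mxE.
  have h1 : f x j i @[x --> flt] --> M j i by exact: cvg_mx_entry.
  have h2 : f x i j @[x --> flt] --> M i j by exact: cvg_mx_entry.
  apply: (cvgr_unique h1).
  apply: cvg_trans h2; apply: near_eq_cvg; near=> x.
  have [sx _] : psd (f x) by near: x.
  by rewrite -{1}sx mxE.
have h : qf (f x) v @[x --> flt] --> qf M v by exact: cvg_qf.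
apply: (cvgr_to_ge h); near=> x.
have [_ pfx] : psd (f x) by near: x.
exact: pfx.
Unshelve. all: by end_near. Qed.

Lemma cvg_mulmx0 {T : Type} (flt : set_system T) {FF : ProperFilter flt}
    k l q (f : T -> 'M[R]_(k, l)) (M : 'M[R]_(k, l)) (v : 'M[R]_(l, q)) :
  (forall i j, f x i j @[x --> flt] --> M i j) ->
  (\forall x \near flt, f x *m v = 0) -> M *m v = 0.
Proof.
move=> fM f0; apply/matrixP => i j.
have h : mulmxr v (f x) i j @[x --> flt] --> mulmxr v M i j.
  exact: cvg_linear_entry.
rewrite [RHS]mxE; apply: (cvgr_unique h).
apply: cvg_near_cst; near=> x.
have fx : f x *m v = 0 by near: x.
by rewrite /= fx mxE.
Unshelve. all: by end_near. Qed.

Lemma is_mx_integral_eq tau k l (X Y : R -> 'M[R]_(k, l)) M :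
  (forall t, 0 <= t -> X t = Y t) -> is_mx_integral tau X M -> is_mx_integral tau Y M.
Proof.
move=> XY.
have e1 t : mx_integrable t X -> mx_integrable t Y.
  move=> h i j; apply: eq_integrable (h i j) => //.
  by move=> s; rewrite inE /= in_itv /= => /andP[s0 _]; rewrite XY.
have e2 t : mx_integral t X = mx_integral t Y.
  apply/matrixP => i j; rewrite !mxE; apply: eq_Rintegral => s.
  by rewrite inE /= in_itv /= => /andP[s0 _]; rewrite XY.
case: tau => [r||] //=; first by move=> [/e1 ? ->]; rewrite e2.
move=> [hi hc]; split=> [t t0|]; first exact/e1/hi.
by under eq_fun do rewrite -e2.
Qed.

Lemma is_mx_integral_unique tau k l (X : R -> 'M[R]_(k, l)) M M' :
  is_mx_integral tau X M -> is_mx_integral tau X M' -> M = M'.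
Proof.
case: tau => [r||] //=; first by move=> [_ ->] [_ ->].
move=> [_ h1] [_ h2]; apply/matrixP => i j.
have c1 : mx_integral t X i j @[t --> +oo] --> M i j by exact: cvg_mx_entry.
have c2 : mx_integral t X i j @[t --> +oo] --> M' i j by exact: cvg_mx_entry.
exact: cvgr_unique c1 c2.
Qed.

Lemma continuous_mx_integrable k l (X : R -> 'M[R]_(k, l)) t :
  (forall i j, continuous (fun s => X s i j)) -> mx_integrable t X.
Proof.
move=> cX i j; apply: (@continuous_compact_integrable R (fun s => X s i j)).
  exact: segment_compact.
exact: continuous_subspaceT.
Qed.

Lemma qf_mx_integral n (X : R -> 'M[R]_n) v t : mx_integrable t X ->
  qf (mx_integral t X) v = \int[mu]_(s in `[0, t]) qf (X s) v.
Proof.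
move=> iX; have [_ e] := mx_integral_linear (mulmxr v \o mulmx v^T) iX.
by rewrite /qf -[_ *m _]e mxE.
Qed.

Lemma psd_mx_integral n (X : R -> 'M[R]_n) t : mx_integrable t X ->
  (forall s, 0 <= s -> psd (X s)) -> psd (mx_integral t X).
Proof.
move=> iX pX; split=> [|v].
  apply/matrixP => i j; rewrite !mxE; apply: eq_Rintegral => s.
  by rewrite inE /= in_itv /= => /andP[/pX[sX _] _]; rewrite -{1}sX mxE.
rewrite qf_mx_integral //; apply: Rintegral_ge0 => s /=.
by rewrite in_itv /= => /andP[/pX[_]].
Qed.

Lemma qf_mx_integral_le n (X : R -> 'M[R]_n) v s t :
  (forall i j, continuous (fun s => X s i j)) ->
  (forall s, 0 <= s -> psd (X s)) -> 0 <= s -> s <= t ->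
  qf (mx_integral s X) v <= qf (mx_integral t X) v.
Proof.
move=> cX pX s0 st.
rewrite !qf_mx_integral; try exact: continuous_mx_integrable.
rewrite -subr_ge0 Rintegral_itvB; last 3 first.
- apply: (@continuous_compact_integrable R (fun s => qf (X s) v)).
    exact: segment_compact.
  apply: continuous_subspaceT; apply: continuous_qf => // i; exact: cst_continuous.
- by rewrite bnd_simp.
- by rewrite bnd_simp.
apply: Rintegral_ge0 => r /=; rewrite in_itv /= => /andP[sr _].
by apply: (pX _ _).2; rewrite ltW // (le_lt_trans s0).
Qed.

Section NonnegativeTime.
Variables (tau : \bar R) (n : nat) (X : R -> 'M[R]_n) (M : 'M[R]_n).
Hypothesis cX : forall i j, continuous (fun s => X s i j).
Hypothesis pX : forall s, 0 <= s -> psd (X s).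
Hypothesis XM : is_mx_integral tau X M.

Lemma is_mx_integral_psd : psd M.
Proof.
case: tau XM => [r||] //= [iX hM].
  by rewrite hM; apply: psd_mx_integral.
apply: (cvg_psd hM); near=> t; apply: psd_mx_integral => //.
by apply: iX; near: t; exact: nbhs_pinfty_ge.
Unshelve. all: by end_near. Qed.

Lemma qf_mx_integral_le_total t v : 0 <= t -> (t%:E <= tau)%E ->
  qf (mx_integral t X) v <= qf M v.
Proof.
move=> t0; case: tau XM => [r||] //= [iX hM]; rewrite ?lee_fin => tr.
  by rewrite hM; apply: qf_mx_integral_le.
have h : qf (mx_integral s X) v @[s --> +oo] --> qf M v by exact: cvg_qf.
apply: (cvgr_to_ge h); near=> s; apply: qf_mx_integral_le => //.
Unshelve. all: by end_near. Qed.

(** The function [G] integrating the quadratic form up to time [s] is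
    nonnegative, and at most [qf M v = 0] at [t]. If its derivative
    [qf (X t) v] at [t] were positive, [G] would be negative just before [t]. *)
Lemma is_mx_integral_ker (v : 'cV[R]_n) t : M *m v = 0 -> 0 < t -> (t%:E <= tau)%E ->
  X t *m v = 0.
Proof.
move=> Mv t0 ttau; have qM : qf M v = 0 by rewrite /qf -mulmxA Mv mulmx0 mxE.
apply: psd_ker; first exact/pX/ltW.
have cq : continuous (fun s => qf (X s) v).
  by apply: continuous_qf => // i; exact: cst_continuous.
pose G (s : R) := \int[mu]_(r in `[0, s]) qf (X r) v.
have GE s : G s = qf (mx_integral s X) v.
  by rewrite qf_mx_integral //; exact: continuous_mx_integrable.
have G_ge0 s : 0 <= G s.
  by rewrite GE; apply: (psd_mx_integral _ pX).2; exact: continuous_mx_integrable.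
have Gt : G t <= 0 by rewrite GE -qM; apply: qf_mx_integral_le_total => //; exact: ltW.
apply/eqP; rewrite eq_le (pX (ltW t0)).2 andbT leNgt; apply/negP => qpos.
have t1 : t < t + 1 by rewrite ltrDl.
have [||dG G'] := @continuous_FTC1 R (fun s => qf (X s) v) (BLeft 0) t _ t1 _ _ (cq t).
- apply: (@continuous_compact_integrable R (fun s => qf (X s) v)).
    exact: segment_compact.
  exact: continuous_subspaceT.
- by rewrite lte_fin.
have [|s [s0 st]] := is_derive_gt0_left t0 qpos (f := G).
  by apply: DeriveDef => //; rewrite -derive1E.
by rewrite ltNge (le_trans Gt).
Qed.

Lemma ker_is_mx_integral (v : 'cV[R]_n) :
  (forall t, 0 < t -> (t%:E < tau)%E -> X t *m v = 0) -> M *m v = 0.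
Proof.
move=> X0.
have int0 t : (t%:E <= tau)%E -> mx_integral t X *m v = 0.
  move=> ttau; have iX := continuous_mx_integrable t cX.
  have [iXv e] := mx_integral_linear (mulmxr v) iX.
  rewrite -[LHS]/(mulmxr v _) -e; apply/matrixP => i j; rewrite !mxE.
  have mf b c : [set` Interval b c] `<=` `[0, t] ->
      mu.-integrable [set` Interval b c] (EFin \o (fun s => (X s *m v) i j)).
    by move=> sub; apply: integrableS (iXv i j) => //; exact: measurable_itv.
  rewrite -Rintegral_itv_obnd_cbnd; last first.
    by apply: mf; apply: subset_itvr; rewrite bnd_simp.
  rewrite -Rintegral_itv_bndo_bndc; last by apply: mf; apply: subset_itvW.
  under eq_Rintegral => s.
    rewrite inE /= in_itv /= => /andP[s0 st].
    rewrite X0 ?mxE //; first over.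
    by rewrite (lt_le_trans _ ttau) // lte_fin.
  by rewrite Rintegral_cst ?mul0r.
case: tau XM int0 => [r||] //= [iX hM] int0; first by rewrite hM int0.
by apply: (cvg_mulmx0 (cvg_mx_entry hM)); apply: nearW => t; apply: int0; rewrite leey.
Qed.
End NonnegativeTime.

Section KernelInvariance.
Variables (tau : \bar R) (n k : nat) (A : 'M[R]_n) (F : 'M[R]_(n, k * n)).
Variables (X0 : 'M[R]_n) (X : R -> 'M[R]_n).
Hypothesis tau0 : (0 < tau)%E.
Hypothesis fX : flow (lyapunov A F) X0 X.
Hypothesis pX0 : psd X0.
Variable v : 'cV[R]_n.
Hypothesis Xv : forall t, 0 < t -> (t%:E < tau)%E -> X t *m v = 0.

Lemma near_lt_ereal t : (t%:E < tau)%E -> \forall s \near t, (s%:E < tau)%E.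
Proof.
case: tau => [r||] //; last by move=> _; near=> s; rewrite ltry.
rewrite lte_fin => tr; near=> s; rewrite lte_fin; near: s; exact: lt_nbhsl.
Unshelve. all: by end_near. Qed.

Lemma flow_ker0 : X0 *m v = 0.
Proof.
have [cX <- _] := fX; apply: (@cvg_mulmx0 _ (0 : R)^'+ _ _ _ _ X) => [i j|].
  exact/cvg_at_right_filter/cX.
near=> s; apply: Xv => //; near: s; rewrite near_withinE.
near=> s => _; near: s; exact: near_lt_ereal.
Unshelve. all: by end_near. Qed.

(** The function [X s *m v] is constant near [t], so its derivative vanishes. *)
Lemma flow_ker_lyapunov t : 0 < t -> (t%:E < tau)%E -> lyapunov A F (X t) *m v = 0.
Proof.
move=> t0 ttau; have [_ _ dX] := fX.
apply/colP => i; rewrite [RHS]mxE.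
have d1 : is_derive t 1 (fun s => (X s *m v) i 0) ((lyapunov A F (X t) *m v) i 0).
  rewrite mxE (_ : (fun s => _) = \sum_b (v b 0 \*: (fun s => X s i b))).
    apply: is_derive_sum => b.
    by apply: is_derive_eq (is_deriveZ (v b 0) (dX t t0 i b)) _; exact: mulrC.
  apply/funext => s; rewrite mxE fct_sumE; apply: eq_bigr => b _; exact: mulrC.
have d2 : is_derive t 1 (fun s => (X s *m v) i 0) 0.
  apply: (@near_eq_is_derive _ _ _ (cst 0)).
  near=> s; rewrite Xv ?mxE //; near: s; first exact: lt_nbhsr.
  exact: near_lt_ereal.
by rewrite -(@derive_val _ _ _ _ _ _ _ d1) (@derive_val _ _ _ _ _ _ _ d2).
Unshelve. all: by end_near. Qed.

(** Of the quadratic form of [lyapunov A F (X t)] at [v], only the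
    semidefinite term with [F] survives. *)
Lemma flow_ker_tens t : 0 < t -> (t%:E < tau)%E ->
  tensmx (1%:M : 'M[R]_k) (X t) *m F^T *m v = 0.
Proof.
move=> t0 ttau; have pXt := flow_psd pX0 fX (ltW t0).
rewrite -mulmxA; apply: psd_ker; first exact/psd_tens/pXt/psd1.
rewrite -(qf_lyapunov_ker A F pXt.1 (Xv t0 ttau)).
by rewrite /qf -mulmxA flow_ker_lyapunov // mulmx0 mxE.
Qed.

(** Once the terms with [F] and with [X t *m v] vanish, this is the last term of
    [lyapunov A F (X t) *m v]. *)
Lemma flow_ker_drift t : 0 < t -> (t%:E < tau)%E -> X t *m (A^T *m v) = 0.
Proof.
move=> t0 ttau; have := flow_ker_lyapunov t0 ttau.
rewrite /lyapunov !mulmxDl -2!(mulmxA F) flow_ker_tens // mulmx0 addr0.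
by rewrite -mulmxA Xv // mulmx0 add0r mulmxA.
Qed.
End KernelInvariance.
End GramianIntegrals.

(** * The kernel of the observability Gramian *)

Section GramianKernel.
Context {R : realType} {n m p : nat}.
Variables (A : 'M[R]_n) (B : 'M[R]_(n, m)) (C : 'M[R]_(p, n)).
Variables (N : 'I_m -> 'M[R]_n) (H : 'I_n -> 'M[R]_n).
Variable tau : \bar R.

Lemma obs_opE : obs_op A N = lyapunov A^T (hblockT N).
Proof. by apply/funext => X; rewrite /obs_op /lyapunov trmxK. Qed.

Lemma tens1_hblockT k (F : 'I_k -> 'M[R]_n) (X : 'M[R]_n) : X^T = X ->
  tensmx (1%:M : 'M[R]_k) X *m (hblockT F)^T = (hblockT (fun j => X *m F j))^T.
Proof.
move=> sX; rewrite -[LHS]trmxK trmx_mul trmxK trmx_tens trmx1 sX.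
rewrite /hblockT mul_hblock_tens1; congr (hblock _)^T.
by apply/funext => j; rewrite trmx_mul sX.
Qed.

Lemma reach_family_psd Z P_ : reach_family A B N H tau Z P_ ->
  forall i, (1 <= i)%N -> psd (P_ i).
Proof.
move=> [Z1 Zi hP] i; elim/ltn_ind: i => i IH i1.
suff [X0 [pX0 sX]] : exists X0, psd X0 /\
    solves_on `[0, +oo[ (fun _ => reach_op A N) X0 (Z i).
  have [Y [fY ZY]] := @solves_on_flow _ _ _ (lyapunov A (hblock N)) _ _ sX.
  apply: (is_mx_integral_psd (flow_psd pX0 fY)).
  exact: is_mx_integral_eq ZY (hP i i1).
have [i2|i2] := leqP 2 i; last first.
  have -> : i = 1%N by apply/eqP; rewrite eqn_leq i1 andbT -ltnS.
  by exists (B *m B^T); split=> //; exact: psd_gram.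
exists (hblock H *m (\sum_(1 <= k < i) tensmx (P_ k) (P_ (i - k)%N)) *m (hblock H)^T).
split; last exact: Zi.
apply: psd_congr; apply: psd_sum_nat => k /andP[k1 ki].
apply: psd_tens; apply: IH => //; first by rewrite ltn_subrL k1 (leq_trans _ i2).
by rewrite subn_gt0.
Qed.

(** Induction along the recursion: equal initial values give equal solutions,
    hence equal integrals, hence equal next initial values. *)
Lemma reach_family_unique Z P_ Z' P_' :
  reach_family A B N H tau Z P_ -> reach_family A B N H tau Z' P_' ->
  forall i, (1 <= i)%N -> P_ i = P_' i.
Proof.
move=> [Z1 Zi hP] [Z1' Zi' hP'] i; elim/ltn_ind: i => i IH i1.
suff [X0 [sX sX']] : exists X0,
    solves_on `[0, +oo[ (fun _ => reach_op A N) X0 (Z i) /\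
    solves_on `[0, +oo[ (fun _ => reach_op A N) X0 (Z' i).
  have [Y [fY ZY]] := @solves_on_flow _ _ _ (lyapunov A (hblock N)) _ _ sX.
  have [Y' [fY' ZY']] := @solves_on_flow _ _ _ (lyapunov A (hblock N)) _ _ sX'.
  apply: (is_mx_integral_unique _ (hP' i i1)).
  apply: is_mx_integral_eq (hP i i1) => t t0.
  by rewrite ZY // ZY' //; exact: flow_unique fY fY' t t0.
have [i2|i2] := leqP 2 i; last first.
  have -> : i = 1%N by apply/eqP; rewrite eqn_leq i1 andbT -ltnS.
  by exists (B *m B^T).
exists (hblock H *m (\sum_(1 <= k < i) tensmx (P_ k) (P_ (i - k)%N)) *m (hblock H)^T).
split; first exact: Zi.
suff -> : \sum_(1 <= k < i) tensmx (P_ k) (P_ (i - k)%N) =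
          \sum_(1 <= k < i) tensmx (P_' k) (P_' (i - k)%N) by exact: Zi'.
apply: eq_big_nat => k /andP[k1 ki].
rewrite (IH k) // (IH (i - k)%N) ?subn_gt0 //.
by rewrite ltn_subrL k1 (leq_trans _ i2).
Qed.

Variables (P_ : nat -> 'M[R]_n) (Y : nat -> R -> 'M[R]_n) (Q_ : nat -> 'M[R]_n).
Variable Q : 'M[R]_n.
Hypothesis tau0 : (0 < tau)%E.
Hypothesis pP : forall i, (1 <= i)%N -> psd (P_ i).
Hypothesis hY : obs_family A C N H tau P_ Y Q_.
Hypothesis hQ : (\sum_(1 <= i < k) Q_ i) @[k --> \oo] --> Q.

Definition obs_init i : 'M[R]_n := if i == 1%N then C^T *m C else
  hblockT H *m (\sum_(1 <= k < i) tensmx (P_ k) (Q_ (i - k)%N)) *m (hblockT H)^T.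

(** Positivity propagates along the recursion: the initial value of index [i]
    is built from the [Q_j] with [j < i]. *)
Lemma obs_family_flow i : (1 <= i)%N ->
  exists X, [/\ flow (lyapunov A^T (hblockT N)) (obs_init i) X,
    psd (obs_init i), is_mx_integral tau X (Q_ i) & psd (Q_ i)].
Proof.
move: hY => [Y1 Yi hI]; elim/ltn_ind: i => i IH i1.
have pX0 : psd (obs_init i).
  rewrite /obs_init; case: eqP => [_|i1'].
    by rewrite -{2}[C]trmxK; exact: psd_gram.
  apply: psd_congr; apply: psd_sum_nat => k /andP[k1 ki].
  apply: psd_tens; first exact: pP.
  have [||X []] := IH (i - k)%N; [|by rewrite subn_gt0|by []].
  by rewrite ltn_subrL k1 (leq_trans _ ki).
have sX : solves_on `[0, +oo[ (fun _ => lyapunov A^T (hblockT N)) (obs_init i) (Y i).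
  rewrite -obs_opE /obs_init; case: eqP => [->|i1'] //; apply: Yi.
  by rewrite ltn_neqAle i1 andbT eq_sym; apply/eqP.
have [X [fX YX]] := @solves_on_flow _ _ _ (lyapunov A^T (hblockT N)) _ _ sX.
have hX : is_mx_integral tau X (Q_ i) by exact: is_mx_integral_eq YX (hI i i1).
exists X; split=> //.
exact: is_mx_integral_psd (flow_psd pX0 fX) hX.
Qed.

Lemma obs_term_psd i : (1 <= i)%N -> psd (Q_ i).
Proof. by move=> /obs_family_flow[X []]. Qed.

Lemma obs_gramian_psd : psd Q.
Proof.
apply: (cvg_psd hQ); apply: nearW => k.
apply: psd_sum_nat => i /andP[i1 _].
exact: obs_term_psd.
Qed.

(** The quadratic form of each semidefinite summand is at most that of the
    sum. *)
Lemma obs_gramian_ker (v : 'cV[R]_n) :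
  Q *m v = 0 <-> forall i, (1 <= i)%N -> Q_ i *m v = 0.
Proof.
split=> [Qv i i1|Qv]; last first.
  apply: (cvg_mulmx0 (cvg_mx_entry hQ)); apply: nearW => k.
  by rewrite mulmx_suml big_nat_cond big1 // => i /andP[/andP[i1 _] _]; exact: Qv.
have pQi := obs_term_psd i1; apply: psd_ker => //.
apply/eqP; rewrite eq_le pQi.2 andbT.
have <- : qf Q v = 0 by rewrite /qf -mulmxA Qv mulmx0 mxE.
have h : qf (\sum_(1 <= j < k) Q_ j) v @[k --> \oo] --> qf Q v by exact: cvg_qf.
apply: (cvgr_to_ge h); near=> k.
have ik : (i < k)%N by near: k; exact: nbhs_infty_gt.
apply: qf_le_sum_nat; last by rewrite i1 ik.
by move=> j /andP[j1 _]; exact: obs_term_psd.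
Unshelve. all: by end_near. Qed.

Lemma obs_ker_flow i (v : 'cV[R]_n) : (1 <= i)%N -> Q *m v = 0 ->
  [/\ obs_init i *m v = 0, Q_ i *m (A *m v) = 0 &
      forall k, Q_ i *m (N k *m v) = 0].
Proof.
move=> i1 /obs_gramian_ker/(_ i i1) Qv.
have [X [fX pX0 hX pQi]] := obs_family_flow i1.
have pX := flow_psd pX0 fX; have [cX _ _] := fX.
have Xv t : 0 < t -> (t%:E < tau)%E -> X t *m v = 0.
  by move=> t0 /ltW; exact: (is_mx_integral_ker cX pX hX Qv t0).
split; first exact: (flow_ker0 tau0 fX Xv).
  apply: (ker_is_mx_integral cX hX) => t t0 tt.
  by rewrite -{1}[A]trmxK; exact: (flow_ker_drift fX pX0 Xv t0 tt).
move=> k; apply: (ker_is_mx_integral cX hX) => t t0 tt.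
have := flow_ker_tens fX pX0 Xv t0 tt.
rewrite tens1_hblockT ?(pX _ (ltW t0)).1 // => /hblockT_ker/(_ k).
by rewrite mulmxA.
Qed.

Lemma obs_ker_output (v : 'cV[R]_n) : Q *m v = 0 -> C *m v = 0.
Proof.
move=> /(obs_ker_flow (leqnn 1))[+ _ _]; rewrite /obs_init eqxx => CCv.
by apply: qf1_eq0; rewrite /qf mulmx1 trmx_mul -!mulmxA (mulmxA C^T) CCv mulmx0 mxE.
Qed.

Lemma obs_ker_drift (v : 'cV[R]_n) : Q *m v = 0 -> Q *m (A *m v) = 0.
Proof. by move=> Qv; apply/obs_gramian_ker => i i1; have [] := obs_ker_flow i1 Qv. Qed.

Lemma obs_ker_bilinear k (v : 'cV[R]_n) : Q *m v = 0 -> Q *m (N k *m v) = 0.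
Proof. by move=> Qv; apply/obs_gramian_ker => i i1; have [] := obs_ker_flow i1 Qv. Qed.

(** The product of [P_k] and [Q_j] is a summand of the initial value of index
    [k + j], and all summands are semidefinite. *)
Lemma obs_ker_tens k j (v : 'cV[R]_n) : (1 <= k)%N -> (1 <= j)%N -> Q *m v = 0 ->
  tensmx (P_ k) (Q_ j) *m ((hblockT H)^T *m v) = 0.
Proof.
move=> k1 j1 Qv; have kj2 : (2 <= k + j)%N by exact: (leq_add k1 j1).
have [+ _ _] := obs_ker_flow (ltnW kj2) Qv.
rewrite /obs_init gtn_eqF // => h.
have pT l : (1 <= l < k + j)%N -> psd (tensmx (P_ l) (Q_ (k + j - l)%N)).
  move=> /andP[l1 lk]; apply: psd_tens; first exact: pP.
  by apply: obs_term_psd; rewrite subn_gt0.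
apply: psd_ker; first by apply: psd_tens; [exact: pP|exact: obs_term_psd].
apply/eqP; rewrite eq_le (psd_tens (pP k1) (obs_term_psd j1)).2 andbT.
have <- : qf (\sum_(1 <= l < k + j) tensmx (P_ l) (Q_ (k + j - l)%N))
    ((hblockT H)^T *m v) = 0.
  by rewrite -qf_congr /qf -mulmxA h mulmx0 mxE.
have := @qf_le_sum_nat _ _ 1 (k + j) k
  (fun l => tensmx (P_ l) (Q_ (k + j - l)%N)) ((hblockT H)^T *m v) pT.
by rewrite addKn; apply; rewrite k1 -[ltnLHS]addn0 ltn_add2l.
Qed.

(** Summing over [k] replaces [P_k] by [P], which can be cancelled because it is
    invertible. *)
Lemma obs_ker_quadratic (P : 'M[R]_n) (v : 'cV[R]_n) :
  (\sum_(1 <= i < k) P_ i) @[k --> \oo] --> P ->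
  P \in unitmx -> Q *m v = 0 -> forall a, Q *m (H a *m v) = 0.
Proof.
move=> hP uP Qv a; apply/obs_gramian_ker => j j1.
pose tensj := fun X : 'M[R]_n => tensmx X (Q_ j).
have lin_tens : linear tensj.
  by move=> c X X'; apply/matrixP => i l; rewrite !mxE mulrDl -mulrA.
pose L := GRing.isLinear.Build _ _ _ _ tensj lin_tens.
pose F : {linear 'M[R]_n -> 'M[R]_(n * n)} := HB.pack tensj L.
have PQ : tensmx P (Q_ j) *m ((hblockT H)^T *m v) = 0.
  apply: (@cvg_mulmx0 _ _ \oo _ _ _ _ (fun k => F (\sum_(1 <= i < k) P_ i)) (F P)).
    by apply: cvg_linear_entry => i l; exact: (cvg_mx_entry hP).
  apply: nearW => k; rewrite linear_sum mulmx_suml big_nat_cond big1 //.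
  by move=> i /andP[/andP[i1 _] _]; exact: obs_ker_tens.
have : tensmx (1%:M : 'M[R]_n) (Q_ j) *m (hblockT H)^T *m v = 0.
  have -> : tensmx (1%:M : 'M[R]_n) (Q_ j) =
      tensmx (invmx P) (1%:M : 'M[R]_n) *m tensmx P (Q_ j).
    by rewrite tensmx_mul mulVmx // mul1mx.
  by rewrite -!mulmxA PQ mulmx0.
rewrite tens1_hblockT ?(obs_term_psd j1).1 // => /hblockT_ker/(_ a).
by rewrite mulmxA.
Qed.
End GramianKernel.

(** * The reduced system *)

Lemma kronvDr (R : realType) k l (a : 'cV[R]_k) (b c : 'cV[R]_l) :
  kronv a (b + c) = kronv a b + kronv a c.
Proof. by apply/matrixP => i j; rewrite !mxE mulrDr. Qed.

Lemma kronvDl (R : realType) k l (a b : 'cV[R]_k) (c : 'cV[R]_l) :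
  kronv (a + b) c = kronv a c + kronv b c.
Proof. by apply/matrixP => i j; rewrite !mxE mulrDl. Qed.

Lemma mul_tens_kronv (R : realType) k k' l l' (M : 'M[R]_(k, k'))
    (W : 'M[R]_(l, l')) (a : 'cV[R]_k') (b : 'cV[R]_l') :
  tensmx M W *m kronv a b = kronv (M *m a) (W *m b).
Proof. exact: (tensmx_mul M W a b). Qed.

(** The component [e] of [x] in the kernel of [Q] contributes only terms in
    that kernel. In [H (x * x)] with [x = z + e], the mixed term with [e] on the
    left is turned around by the symmetry of [H]. *)
Lemma quad_rhs_reduce (R : realType) (n m r : nat) (A : 'M[R]_n)
    (B : 'M[R]_(n, m)) (N : 'I_m -> 'M[R]_n) (H : 'I_n -> 'M[R]_n)
    (Q : 'M[R]_n) (W : 'M[R]_(n, r)) (u v : R -> 'cV[R]_m) :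
  Q *m (1%:M - W *m W^T) = 0 ->
  (forall z : 'cV[R]_n, Q *m z = 0 -> W^T *m z = 0) ->
  (forall z : 'cV[R]_n, Q *m z = 0 -> Q *m (A *m z) = 0) ->
  (forall k (z : 'cV[R]_n), Q *m z = 0 -> Q *m (N k *m z) = 0) ->
  (forall k (z : 'cV[R]_n), Q *m z = 0 -> Q *m (H k *m z) = 0) ->
  (forall a b : 'cV[R]_n, hblock H *m kronv a b = hblock H *m kronv b a) ->
  forall t x, W^T *m quad_rhs A B (hblock N) (hblock H) u v t x =
    quad_rhs (W^T *m A *m W) (W^T *m B)
         (W^T *m hblock N *m tensmx (1%:M : 'M[R]_m) W)
         (W^T *m hblock H *m tensmx W W) u v t (W^T *m x).
Proof.
move=> QW WQ QA QN QH symH t x; rewrite /quad_rhs.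
pose e := (1%:M - W *m W^T) *m x; pose z := W *m (W^T *m x).
have xE : x = z + e by rewrite /e /z mulmxBl mul1mx mulmxA addrC subrK.
have Qe : Q *m e = 0 by rewrite mulmxA QW mul0mx.
have WN a : W^T *m (hblock N *m kronv a e) = 0.
  apply: WQ; rewrite hblock_kronv mulmx_sumr big1 // => k _.
  by rewrite -scalemxAr QN // scaler0.
have WH a : W^T *m (hblock H *m kronv a e) = 0.
  apply: WQ; rewrite hblock_kronv mulmx_sumr big1 // => k _.
  by rewrite -scalemxAr QH // scaler0.
rewrite !mulmxDr; congr (_ + _ + _ + _).
- by rewrite {1}xE !mulmxDr (WQ _ (QA _ Qe)) addr0 /z !mulmxA.
- by rewrite mulmxA.
- rewrite {1}xE kronvDr !mulmxDr WN addr0 -!mulmxA; do 2!congr (_ *m _).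
  by rewrite mul_tens_kronv mul1mx.
- rewrite {1 2}xE kronvDl !kronvDr !mulmxDr (symH e z) !WH !addr0 -!mulmxA.
  by do 2!congr (_ *m _); rewrite mul_tens_kronv.
Qed.

Theorem proposition3p9 (R : realType) (n m p r : nat) (T : R)
    (A : 'M[R]_n) (B : 'M[R]_(n, m)) (C : 'M[R]_(p, n))
    (N : 'I_m -> 'M[R]_n) (H : 'I_n -> 'M[R]_n)
    (u v : R -> 'cV[R]_m) (x : R -> 'cV[R]_n) (y : R -> 'cV[R]_p)
    (tau : \bar R) (P Q : 'M[R]_n) (W : 'M[R]_(n, r))
    (hT : 0 < T)
    (hu : square_integrable_on T u) (hv : square_integrable_on T v)
    (htau : tau = T%:E \/ tau = +oo%E)
    (hQ : is_obs_gramian A B C N H tau Q)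
    (hx : solves_on `[0, T]%classic (quad_rhs A B (hblock N) (hblock H) u v) 0 x)
    (hy : forall t, `[0, T]%classic t -> y t = C *m x t)
    (hr : (r <= n)%N)
    (hW : nonzero_eigenbasis Q W)
    (hP : is_reach_gramian A B N H tau P)
    (hPinv : P \in unitmx)
    (hH : forall a b : 'cV[R]_n,
        hblock H *m kronv a b = hblock H *m kronv b a) :
  exists xhat : R -> 'cV[R]_r,
    (forall t, `[0, T]%classic t -> y t = C *m W *m xhat t) /\
    solves_on `[0, T]%classic
      (quad_rhs (W^T *m A *m W) (W^T *m B)
         (W^T *m hblock N *m tensmx (1%:M : 'M[R]_m) W)
         (W^T *m hblock H *m tensmx W W) u v) 0 xhat.
Proof.
have tau0 : (0 < tau)%E by case: htau => ->; rewrite ?lte_fin ?ltry.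
have [Z [P_ [Y [Q_ [hZ hY cQ]]]]] := hQ.
have [Z' [P_' [hZ' cP']]] := hP.
have pP := reach_family_psd hZ.
have cP : \sum_(1 <= i < k) P_ i @[k --> \oo] --> P.
  have -> : (fun k => \sum_(1 <= i < k) P_ i) = (fun k => \sum_(1 <= i < k) P_' i).
    apply/funext => k; apply: eq_big_nat => i /andP[i1 _].
    exact: reach_family_unique hZ hZ' i i1.
  exact: cP'.
have sQ := (obs_gramian_psd pP hY cQ).1.
have QW := nonzero_eigenbasis_proj sQ hW.
have WQ (z : 'cV[R]_n) : Q *m z = 0 -> W^T *m z = 0.
  exact: nonzero_eigenbasis_ker sQ hW.
have xhatE := quad_rhs_reduce B u v QW WQ (obs_ker_drift tau0 pP hY cQ)
  (obs_ker_bilinear tau0 pP hY cQ)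
  (fun a z Qz => obs_ker_quadratic tau0 pP hY cQ cP hPinv Qz a) hH.
exists (fun t => W^T *m x t); split=> [t t0T|t t0T].
  rewrite hy // -!mulmxA; apply/eqP; rewrite -subr_eq0 -mulmxBr; apply/eqP.
  apply: (obs_ker_output tau0 pP hY cQ).
  by rewrite -{1}[x t]mul1mx mulmxA -mulmxBl mulmxA QW mul0mx.
have [ix xE] := hx t t0T.
have [iWx WxE] := mx_integral_linear (mulmx W^T) ix.
have rhsE : (fun s => W^T *m quad_rhs A B (hblock N) (hblock H) u v s (x s)) =
    (fun s => quad_rhs (W^T *m A *m W) (W^T *m B)
         (W^T *m hblock N *m tensmx (1%:M : 'M[R]_m) W)
         (W^T *m hblock H *m tensmx W W) u v s (W^T *m x s)).
  by apply/funext => s; exact: xhatE.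
by rewrite -rhsE; split; [exact: iWx|rewrite WxE {1}xE !add0r].
Qed.
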